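(* Let $\{X(t):t\ge 0\}$ be an absolutely continuous $d\times d$ Hermitian Lévy process, and for each $t\ge 0$ let $\lambda(t)=(\lambda_1(t),\dots,\lambda_d(t))$ be the vector of eigenvalues of $X(t)$, where $\lambda_1(t)\ge\lambda_2(t)\ge\cdots\ge\lambda_d(t)$. Then, almost surely, the following holds for every $t>0$: if $X$ has a jump of rank one at time $t$ and the matrices $X(t)$ and $X(t-)$ do not commute, then $\Delta\lambda(t)\ne 0$. Moreover, in this situation, $\Delta\lambda_i(t)\neq 0$ for some $i\in\{1,\dots,d\}$ if and only if $\Delta\lambda_j(t)\ne 0$ for all $j\ne i$.
   Context: A $d\times d$ Hermitian Lévy process is a Lévy process (càdlàg paths, stationary independent increments) with values in the real vector space $\mathbb{H}_d$ of $d\times d$ complex Hermitian matrices, identified with $\mathbb{R}^{d^2}$ through the real diagonal entries and the real and imaginary parts of the entries above the diagonal. It is called absolutely continuous if for every $t>0$ the law of $X(t)$ is absolutely continuous with respect to Lebesgue measure on $\mathbb{H}_d\cong\mathbb{R}^{d^2}$. $X(t-)$ denotes the left limit at $t$ and $\Delta X(t)=X(t)-X(t-)$; $X$ has a jump of rank one at $t$ if $\Delta X(t)$ is a matrix of rank one. Similarly $\Delta\lambda(t)=\lambda(t)-\lambda(t-)$ and $\Delta\lambda_i(t)=\lambda_i(t)-\lambda_i(t-)$, where $\lambda_i(t-)$ is the left limit, equal to the $i$-th largest eigenvalue of $X(t-)$. *)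

(* Defs.v *)
From HB Require Import structures.
From mathcomp Require Import all_boot all_order all_algebra.
From mathcomp Require Import complex spectral.
From mathcomp Require Import all_classical all_reals all_analysis.

Set Implicit Arguments.
Unset Strict Implicit.
Unset Printing Implicit Defensive.
Import Order.TTheory GRing.Theory Num.Theory.
Import numFieldNormedType.Exports.
Local Open Scope classical_set_scope.
Local Open Scope ring_scope.
Local Open Scope complex_scope.

Section tuple_measure.
Context {d} {E : measurableType d} {R : realType}.

Definition tuple_cons n (p : E * n.-tuple E) : n.+1.-tuple E :=
  [tuple of p.1 :: p.2].

Lemma measurable_tuple_cons n : measurable_fun [set: _] (@tuple_cons n).
Proof. exact: measurable_cons. Qed.

Section step.
Variables (nu : {sigma_finite_measure set E -> \bar R}) (n : nat).
Variable mu : {sigma_finite_measure set (n.-tuple E) -> \bar R}.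

Definition tuple_measureS : set (n.+1.-tuple E) -> \bar R :=
  pushforward (nu \x mu)%E (@tuple_cons n).

Let tuple_measureS0 : tuple_measureS set0 = 0%E.
Proof. by rewrite /tuple_measureS /pushforward preimage_set0 measure0. Qed.

Let tuple_measureS_ge0 A : (0 <= tuple_measureS A)%E.
Proof. by rewrite /tuple_measureS /pushforward measure_ge0. Qed.

Let tuple_measureS_additive : semi_sigma_additive tuple_measureS.
Proof.
have mcons A : measurable A -> measurable (@tuple_cons n @^-1` A).
  by move=> mA; rewrite -[X in measurable X]setTI; exact: measurable_tuple_cons.
move=> F mF tF mUF; rewrite /tuple_measureS /pushforward preimage_bigcup.
apply: measure_semi_sigma_additive.
- by move=> k; exact: mcons.
- apply/trivIsetP => /= i j _ _ ij; rewrite -preimage_setI.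
  by move/trivIsetP : tF => /(_ _ _ _ _ ij) ->//; rewrite preimage_set0.
- by rewrite -preimage_bigcup; exact: mcons.
Qed.

HB.instance Definition _ := isMeasure.Build _ _ _ tuple_measureS
  tuple_measureS0 tuple_measureS_ge0 tuple_measureS_additive.

Lemma tuple_measureS_sigma_finite : sigma_finite setT tuple_measureS.
Proof.
have /sigma_finiteP[F [FT ndF mF]] := sigma_finiteT nu.
have /sigma_finiteP[G [GT ndG mG]] := sigma_finiteT mu.
pose unc (t : n.+1.-tuple E) : E * n.-tuple E := (thead t, [tuple of behead t]).
have uncK : cancel unc (@tuple_cons n).
  by move=> t; rewrite [RHS]tuple_eta; apply: val_inj.
have consK : cancel (@tuple_cons n) unc.
  move=> [x t]; congr pair; rewrite ?theadE//=; exact: val_inj.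
have munc : measurable_fun setT unc.
  apply: measurable_fun_pair; first exact: measurable_tnth.
  exact: measurable_behead.
exists (fun k => unc @^-1` (F k `*` G k)) => [|k].
  apply/esym/seteqP; split => // t _.
  have : (\bigcup_k F k) (unc t).1 by rewrite -FT.
  have : (\bigcup_k G k) (unc t).2 by rewrite -GT.
  move=> [b _ Gb] [a _ Fa]; exists (maxn a b) => //; split.
    by move: Fa; exact/subsetPset/ndF/leq_maxl.
  by move: Gb; exact/subsetPset/ndG/leq_maxr.
have [[mFk Fkoo] [mGk Gkoo]] := (mF k, mG k); split.
  by rewrite -[X in measurable X]setTI; apply: munc => //; exact: measurableX.
rewrite /tuple_measureS /pushforward -comp_preimage.
rewrite (_ : unc \o _ = id); last by apply/funext => x /=; rewrite consK.
by rewrite preimage_id product_measure1E// lte_mul_pinfty// ge0_fin_numE.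
Qed.

HB.instance Definition _ := Measure_isSigmaFinite.Build _ _ _ tuple_measureS
  tuple_measureS_sigma_finite.

End step.

Fixpoint tuple_measure (nu : {sigma_finite_measure set E -> \bar R}) n :
    {sigma_finite_measure set (n.-tuple E) -> \bar R} :=
  match n with
  | 0 => dirac ([tuple] : 0.-tuple E)
  | m.+1 => tuple_measureS nu (tuple_measure nu m)
  end.

End tuple_measure.

Section tuple_measure_box.
Context {d} {E : measurableType d} {R : realType}.
Variable nu : {sigma_finite_measure set E -> \bar R}.

Lemma tuple_measure_box n (A : 'I_n -> set E) : (forall i, measurable (A i)) ->
  tuple_measure nu n [set t | forall i, A i (tnth t i)] =
  (\prod_(i < n) nu (A i))%E.
Proof.
elim: n A => [|n IHn] A mA.
  rewrite big_ord0 /= diracE mem_set//= => -[].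
  by [].
rewrite big_ord_recl -IHn//= /tuple_measureS /pushforward -product_measure1E//; last first.
  have -> : [set t | forall i, A (lift ord0 i) (tnth t i)] =
    \bigcap_i ((@tnth n E)^~ i @^-1` A (lift ord0 i)).
    by apply/seteqP; split => t /=; [move=> h i _; exact: h|move=> h i; exact: h].
  apply: fin_bigcap_measurable => // i _.
  by rewrite -[X in measurable X]setTI; exact: measurable_tnth.
congr (product_measure1 _ _ _); apply/seteqP; split => -[x t] /=.
- move=> h; split; first exact: (h ord0).
  by move=> i; have := h (lift ord0 i); rewrite tnthS.
- move=> [Ax At] i; case: (unliftP ord0 i) => [j ->|-> //].
  by rewrite tnthS.
Qed.

End tuple_measure_box.

Section independence.
Context {dO dE} {Omega : measurableType dO} {E : measurableType dE}
  {R : realType}.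

(* Taking some B i to be setT gives the product rule over every subfamily. *)
Definition mutually_independent (P : probability Omega R) n
    (Y : 'I_n -> Omega -> E) :=
  forall B : 'I_n -> set E, (forall i, measurable (B i)) ->
  P (\bigcap_i (Y i @^-1` B i)) = (\prod_(i < n) P (Y i @^-1` B i))%E.

End independence.

Section hermitian_processes.
Context {R : realType} {d : nat}.
Implicit Types (A : 'M[R[i]]_d) (x : R -> 'M[R[i]]_d) (t : R).

(* The identification of the Hermitian matrices with R^(d * d): the real parts
   of the entries (i, j), i <= j, are stored at (i, j), and the imaginary parts
   of the entries above the diagonal are stored at the transposed position. *)
Definition herm_coord A : (d * d).-tuple R :=
  [tuple mxvec (\matrix_(i < d, j < d)
    if (i <= j)%N then complex.Re (A i j) else complex.Im (A j i)) ord0 k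
  | k < d * d].

Definition cadlag (T : ptopologicalType) (f : R -> T) :=
  (forall t, 0 <= t -> f s @[s --> t^'+] --> f t) /\
  (forall t, 0 < t -> cvg (f s @[s --> t^'-])).

(* R[i] carries no topology in the library, so convergence of complex matrices
   is that of their real and imaginary parts. *)
Definition cadlag_cmx x :=
  cadlag (fun t => map_mx (@complex.Re R) (x t)) /\
  cadlag (fun t => map_mx (@complex.Im R) (x t)).

Definition left_lim_cmx x t : 'M[R[i]]_d :=
  \matrix_(i, j)
    ((lim (map_mx (@complex.Re R) (x s) @[s --> t^'-]) : 'M[R]_d) i j +i*
     (lim (map_mx (@complex.Im R) (x s) @[s --> t^'-]) : 'M[R]_d) i j).

Definition jump_cmx x t := x t - left_lim_cmx x t.

(* For A Hermitian, the entries of spectral_diag A are the eigenvalues of A,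
   repeated according to multiplicity; they are real. *)
Definition eigvals A : 'rV[R]_d :=
  \row_i nth 0 (sort >=%R [seq complex.Re (spectral_diag A ord0 j)
                          | j <- enum 'I_d]) i.

Definition jump_eigvals x t : 'rV[R]_d :=
  eigvals (x t) - lim (eigvals (x s) @[s --> t^'-]).

Lemma eigvals_sorted A (i j : 'I_d) : (i <= j)%N ->
  eigvals A ord0 j <= eigvals A ord0 i.
Proof.
move=> ij; rewrite !mxE.
have tr : transitive (>=%R : rel R) by move=> a b c /= ba cb; exact: le_trans cb ba.
have so := sort_sorted (fun a b : R => le_total b a)
  [seq complex.Re (spectral_diag A ord0 j) | j <- enum 'I_d].
apply: (sorted_leq_nth tr (fun a => lexx a) 0 so) => //.
  by rewrite inE size_sort size_map size_enum_ord.
by rewrite inE size_sort size_map size_enum_ord.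
Qed.

Lemma char_poly_eigvals A : A \is hermsymmx ->
  char_poly A = \prod_(i < d) ('X - ((eigvals A ord0 i)%:C)%:P).
Proof.
move=> hA.
have /orthomx_spectralP AE := hermitian_normalmx hA.
have /mxOverP hre := hermitian_spectral_diag_real hA.
transitivity (\prod_(i < d) ('X - (spectral_diag A ord0 i)%:P)).
  have -> : char_poly A = char_poly (diag_mx (spectral_diag A)).
    set S := spectralmx A in AE *; set D := diag_mx _ in AE *.
    have uS : S \in unitmx := spectral_unit A.
    have VS : map_mx polyC (invmx S) *m map_mx polyC S = 1%:M.
      by rewrite -map_mxM mulVmx// map_mx1.
    have char_mxA : char_poly_mx A =
        map_mx polyC (invmx S) *m char_poly_mx D *m map_mx polyC S.
      rewrite /char_poly_mx mulmxBr mulmxBl scalar_mxC.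
      by rewrite -['X%:M *m _ *m _]mulmxA VS mulmx1 {1}AE !map_mxM.
    rewrite /char_poly char_mxA !det_mulmx mulrAC -det_mulmx VS.
    by rewrite det1 mul1r.
  rewrite char_poly_trig ?diag_mx_is_trig//.
  by apply: eq_bigr => i _; rewrite !mxE eqxx mulr1n.
pose s := [seq complex.Re (spectral_diag A ord0 j) | j <- enum 'I_d].
have sz : size (sort >=%R s) = d by rewrite size_sort size_map size_enum_ord.
transitivity (\prod_(a <- sort >=%R s) ('X - (a%:C)%:P)); last first.
  by rewrite (big_nth 0) sz big_mkord; apply: eq_bigr => i _; rewrite mxE.
rewrite (perm_big s)/=; last by rewrite perm_sort.
rewrite big_map big_enum/=; apply: eq_bigr => i _.
by rewrite RRe_real.
Qed.

End hermitian_processes.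

Section levy.
Context {R : realType} {dO : measure_display} {Omega : measurableType dO}.
Variables (P : probability Omega R) (d : nat).
Variable X : R -> Omega -> 'M[R[i]]_d.

Definition incr (s t : R) (w : Omega) : (d * d).-tuple R :=
  herm_coord (X t w - X s w).

(* A process is indexed by R, but only its values at times t >= 0 matter. *)
Record hermitian_levy_process : Prop := HermitianLevyProcess {
  levy_hermitian : forall t w, 0 <= t -> X t w \is hermsymmx ;
  levy_measurable : forall t, 0 <= t ->
    measurable_fun [set: Omega] (fun w => herm_coord (X t w)) ;
  levy_start : {ae P, forall w, X 0 w = 0} ;
  levy_independent : forall n (t : nat -> R),
    0 <= t 0%N -> (forall k, t k <= t k.+1) ->
    mutually_independent P (fun k : 'I_n => incr (t k) (t k.+1)) ;
  levy_stationary : forall s h, 0 <= s -> 0 <= h ->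
    forall B, measurable B ->
    P (incr s (s + h) @^-1` B) = P (incr 0 h @^-1` B) ;
  levy_cadlag : {ae P, forall w, cadlag_cmx (X ^~ w)}
}.

Definition absolutely_continuous_process := forall t, 0 < t ->
  pushforward P (fun w => herm_coord (X t w))
    `<< tuple_measure (@lebesgue_measure R) (d * d).

End levy.

(* Main.v *)
Require Import Defs.
From HB Require Import structures.
From mathcomp Require Import all_boot all_order all_algebra.
From mathcomp Require Import fingroup perm complex spectral.
From mathcomp Require Import all_classical all_reals all_analysis.
From mathcomp Require Import measurable_realfun lra ring.

Set Implicit Arguments.
Unset Strict Implicit.
Unset Printing Implicit Defensive.
Import Order.TTheory GRing.Theory Num.Theory.
Import numFieldNormedType.Exports.
Local Open Scope classical_set_scope.
Local Open Scope ring_scope.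
Local Open Scope complex_scope.

(** A time t > 0 lies after some a = 1/(n+1).  The pairs
(X(t-) - X(a), X(t) - X(t-)) with t > a a jump time are functions of the
increments after a, hence independent of X(a), and there are only countably many
of them.  For a fixed pair (Y, B) with B of rank one, the matrices A such that
A + Y and A + Y + B have a common eigenvalue are the zeros of a nonzero polynomial
(the determinant of a Sylvester operator), so X(a) almost surely avoids them.  By
Fubini, almost surely no rank one jump keeps an eigenvalue; as the ordered
eigenvalues depend continuously on the matrix, every one of them jumps at such a
time.

The family of jumps is not handled measurably: the exceptional event is replaced
by a larger one expressed through the increments along the dyadic grids after a,
whose section at each cadlag path is still a countable union of null sets. *)

(** * Common eigenvalues under rank one perturbations *)

Section common_eigenvalues.
Context {C : numClosedFieldType} {d : nat}.
Implicit Types A B M : 'M[C]_d.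
Local Open Scope sesquilinear_scope.

(* The determinant of the Sylvester operator M |-> A M - M B, that is, the
   resultant of the characteristic polynomials of A and B up to sign. *)
Definition sylvester A B := \det (lin_mulmx A - lin_mulmxr B).

Lemma sylvester_eq0P A B :
  sylvester A B = 0 <-> exists2 M, M != 0 & A *m M = M *m B.
Proof.
split => [/eqP /det0P [v v0 vAB]|[M M0 AM]].
  exists (vec_mx v); first by rewrite -mxvec_eq0 vec_mxK.
  apply/eqP; rewrite -subr_eq0 -mxvec_eq0; apply/eqP.
  by move: vAB; rewrite -{1}[v]vec_mxK mulmxBr !mul_vec_lin /= linearB.
apply/eqP/det0P; exists (mxvec M); first by rewrite mxvec_eq0.
by rewrite mulmxBr !mul_vec_lin /= AM subrr.
Qed.

(** A row eigenvector [u] of [A^T] and a row eigenvector [w] of [B] for the same eigenvalue give the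
    nonzero matrix [u^T *m w], which intertwines [A] and [B]. *)
Lemma sylvester_common_root A B (a : C) :
  root (char_poly A) a -> root (char_poly B) a -> sylvester A B = 0.
Proof.
have char_tr : char_poly A^T = char_poly A.
  rewrite /char_poly -det_tr /char_poly_mx; congr (\det _).
  by apply/matrixP => i j; rewrite !mxE eq_sym.
rewrite -char_tr -!eigenvalue_root_char.
move=> /eigenvalueP[u uA u0] /eigenvalueP[w wB w0].
apply/sylvester_eq0P; exists (u^T *m w).
  have /rV0Pn [i ui] := u0; have /rV0Pn [j wj] := w0.
  apply/eqP => /matrixP /(_ i j) /eqP.
  by rewrite !mxE big_ord1 !mxE mulf_eq0 (negbTE ui) (negbTE wj).
by rewrite -mulmxA wB -scalemxAr mulmxA -[A]trmxK -trmx_mul uA linearZ -scalemxAl.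
Qed.

End common_eigenvalues.

Section generic_rank_one.
Context {C : numClosedFieldType} {d : nat}.
Local Open Scope sesquilinear_scope.

(** The spectral matrix [U] of [v v^*] makes [y y^*] diagonal for [y = U v], and a nonzero vector
    with this property has exactly one nonzero entry. *)
Lemma unitary_to_axis (v : 'cV[C]_d) : v != 0 ->
  exists2 U : 'M[C]_d, U \is unitarymx &
  exists k, exists2 y, y != 0 & U *m v = y *: delta_mx k ord0.
Proof.
move=> v0; pose B := v *m v^t*.
have hB : B \is hermsymmx.
  apply/is_hermitianmxP; rewrite expr0 scale1r /B.
  by rewrite trmx_mul map_mxM trmxCK.
have nB := hermitian_normalmx hB.
have /orthomx_spectralP BE := nB.
set U := spectralmx B in BE; have uU : U \is unitarymx := spectral_unitarymx B.
exists U => //.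
have Uu := unitarymx_unit uU.
have [y Uv] : {y | U *m v = y} by exists (U *m v).
have yy : y *m y^t* = diag_mx (spectral_diag B).
  rewrite -Uv trmx_mul map_mxM mulmxA -[U *m v *m _]mulmxA -/B.
  rewrite -invmx_unitary// [in U *m B]BE -/U -!mulmxA mulKVmx//.
  by rewrite mulmxV// mulmx1.
have y0 : y != 0.
  apply: contra v0 => /eqP y0; apply/eqP.
  by rewrite -[v](mulKmx Uu) Uv y0 mulmx0.
have /cV0Pn [k yk] := y0; exists k, (y k ord0) => //.
apply/matrixP => i j; rewrite Uv ord1 !mxE eqxx andbT.
have [->|ik] := eqVneq i k; first by rewrite mulr1.
rewrite mulr0; have /matrixP /(_ i k) := yy; rewrite !mxE big_ord1 !mxE.
move=> /eqP; rewrite (negbTE ik) mulr0n mulf_eq0 conjC_eq0 (negbTE yk) orbF.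
by move/eqP.
Qed.

Lemma unitary_transitive (v w : 'cV[C]_d) : v != 0 -> w != 0 ->
  exists2 U : 'M[C]_d, U \is unitarymx & exists2 z, z != 0 & U *m v = z *: w.
Proof.
move=> /unitary_to_axis[U uU [k [y y0 Uv]]] /unitary_to_axis[V uV [l [z z0 Vw]]].
have pm : (perm_mx (tperm k l) : 'M[C]_d) \is unitarymx.
  apply/unitarymxP; rewrite tr_perm_mx map_perm_mx -perm_mxM.
  by rewrite mulgV perm_mx1.
exists (V^t* *m perm_mx (tperm k l) *m U).
  by rewrite !mul_unitarymx// trmxC_unitary.
exists (y / z); first by rewrite mulf_neq0// invr_eq0.
rewrite -!mulmxA Uv -!scalemxAr.
have -> : perm_mx (tperm k l) *m delta_mx k ord0 = delta_mx l ord0 :> 'cV[C]_d.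
  apply/matrixP => i j; rewrite -row_permE !mxE !ord1 eqxx !andbT.
  rewrite -(inj_eq (@perm_inj _ (tperm k l))) tpermK tpermL.
  by [].
have -> : delta_mx l ord0 = z^-1 *: (V *m w) by rewrite Vw scalerA mulVf// scale1r.
by rewrite -scalemxAr scalerA -invmx_unitary// mulKmx// unitarymx_unit.
Qed.

(* A rank one Hermitian matrix is unitarily conjugate to a multiple of the
   all-ones matrix J, and diag(0, .., d-1) has no eigenvalue in common with
   diag(0, .., d-1) + g J when g is nonzero. *)
Lemma exists_sylvester_neq0 (B : 'M[C]_d) : B \is hermsymmx -> B != 0 ->
  (forall i j k l, B i j * B k l = B i l * B k j) ->
  exists2 A : 'M[C]_d, A \is hermsymmx & sylvester A (A + B) != 0.
Proof.
move=> /is_hermitianmxP; rewrite expr0 scale1r => hB B0 minB.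
have hBe i j : B i j = Num.conj (B j i) by rewrite {1}hB !mxE.
(* The minors on rows and columns [i], [j] give [B i i * B j j = |B i j|^2], so a nonzero entry
   forces a nonzero diagonal entry in its row. *)
have [k Bkk] : exists k, B k k != 0.
  have /matrix0Pn [i [j Bne]] := B0; exists i; apply: contra Bne => /eqP Bii.
  have := minB i i j j; rewrite Bii mul0r [B j i]hBe -normCK => /esym/eqP.
  by rewrite expf_eq0 /= normr_eq0.
pose v : 'cV[C]_d := \col_i B i k.
have v0 : v != 0 by apply/cV0Pn; exists k; rewrite mxE.
have BE : B = (B k k)^-1 *: (v *m v^t*).
  apply/matrixP => i j; rewrite !mxE big_ord1 !mxE -hBe.
  by rewrite minB mulrC mulfK.
pose w : 'cV[C]_d := const_mx 1.
have w0 : w != 0 by apply/cV0Pn; exists k; rewrite mxE oner_eq0.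
have [U uU [z z0 Uv]] := unitary_transitive v0 w0.
have Uu := unitarymx_unit uU.
pose D : 'M[C]_d := diag_mx (\row_i (i : nat)%:R).
pose g := (B k k)^-1 * (z * Num.conj z).
have g0 : g != 0 by rewrite /g !mulf_neq0 ?invr_eq0 ?conjC_eq0.
have UB : U *m B *m U^t* = g *: const_mx 1.
  rewrite BE -scalemxAr -scalemxAl /g -scalerA; congr (_ *: _).
  rewrite !mulmxA Uv -!mulmxA -map_mxM -trmx_mul Uv.
  apply/matrixP => i j; rewrite !mxE big_ord1 !mxE.
  by rewrite !mulr1.
exists (U^t* *m D *m U).
  apply/is_hermitianmxP; rewrite expr0 scale1r.
  rewrite !trmx_mul !map_mxM trmxCK !mulmxA; congr (_ *m _ *m _).
  apply/matrixP => i j; rewrite !mxE rmorphMn /= conjC_nat eq_sym.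
  by case: eqVneq => [->|].
apply/eqP => /sylvester_eq0P[M M0 AM]; case/negP: M0.
have [N NE] : {N | N = U *m M *m U^t*} by exists (U *m M *m U^t*).
have UUt : U *m U^t* = 1%:M by rewrite -invmx_unitary// mulmxV.
have UtU : U^t* *m U = 1%:M by rewrite -invmx_unitary// mulVmx.
have DN : D *m N = N *m D + g *: (N *m const_mx 1).
  have -> : D *m N = U *m (U^t* *m D *m U *m M) *m U^t*.
    by rewrite NE !mulmxA UUt mul1mx.
  rewrite AM scalemxAr -UB NE mulmxDr mulmxDr mulmxDl; congr (_ + _).
    by rewrite !mulmxA -[X in X = _]mulmxA UUt mulmx1.
  by rewrite !mulmxA -[U *m M *m U^t* *m U]mulmxA UtU mulmx1.
have Ne (i j : 'I_d) : (i : nat)%:R * N i j = N i j * (j : nat)%:R + g * \sum_k N i k.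
  move/matrixP : DN => /(_ i j).
  rewrite mul_diag_mx mul_mx_diag !mxE => ->; congr (_ + _ * _).
  by apply: eq_bigr => l _; rewrite mxE mulr1.
(* The diagonal equations force the row sums of [N] to vanish. The distinct diagonal entries of [D]
   then kill the off-diagonal entries, and the row sums kill the diagonal. *)
have sum0 (i : 'I_d) : \sum_k N i k = 0.
  have := Ne i i; rewrite mulrC => /eqP.
  by rewrite -subr_eq0 opprD addrA subrr add0r oppr_eq0 mulf_eq0 (negbTE g0) => /eqP.
have offdiag (i j : 'I_d) : i != j -> N i j = 0.
  move=> ij; have := Ne i j; rewrite sum0 mulr0 addr0 mulrC => /eqP.
  rewrite -subr_eq0 -mulrBr mulf_eq0 subr_eq0 eqr_nat => /orP[/eqP//|].
  by rewrite (inj_eq val_inj) (negbTE ij).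
have N0 : N = 0.
  apply/matrixP => i j; rewrite mxE; have [<-|/offdiag//] := eqVneq i j.
  rewrite -(sum0 i) (bigD1 i)//= big1 ?addr0// => l li.
  by rewrite offdiag// eq_sym.
have -> : M = U^t* *m N *m U.
  by rewrite NE !mulmxA UtU mul1mx -mulmxA UtU mulmx1.
by rewrite N0 mulmx0 mul0mx.
Qed.

Lemma rank1_minors (B : 'M[C]_d) : \rank B = 1%N ->
  forall i j k l, B i j * B k l = B i l * B k j.
Proof.
move=> rB; have := mulmx_base B; move: (col_base B) (row_base B).
rewrite rB => u w <- i j k l.
by rewrite !mxE !big_ord1 mulrACA [w _ _ * _]mulrC mulrACA.
Qed.

End generic_rank_one.

(** * Zero sets of polynomials *)

Section function_algebras.
Context {T : Type} {C : comNzRingType}.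

(** Measurability, convergence and polynomiality in each coordinate are all stable under polynomial
    operations. This common interface lets closure under determinants and Hermitian coordinates be
    proved once for the three. *)
Record fun_algebra (K : set (T -> C)) : Prop := FunAlgebra {
  fun_algebra_cst : forall c, K (fun=> c) ;
  fun_algebraD : forall f g, K f -> K g -> K (fun t => f t + g t) ;
  fun_algebraM : forall f g, K f -> K g -> K (fun t => f t * g t) }.

Variable K : set (T -> C).
Hypothesis hK : fun_algebra K.

Lemma fun_algebraN f : K f -> K (fun t => - f t).
Proof.
move=> Kf; under eq_fun do rewrite -mulN1r.
by apply: (fun_algebraM hK) => //; exact: (fun_algebra_cst hK).
Qed.

Lemma fun_algebra_sum (I : Type) (s : seq I) (F : I -> T -> C) :
  (forall i, K (F i)) -> K (fun t => \sum_(i <- s) F i t).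
Proof.
move=> KF; elim: s => [|i s IHs].
  by under eq_fun do rewrite big_nil; exact: (fun_algebra_cst hK).
by under eq_fun do rewrite big_cons; exact: (fun_algebraD hK).
Qed.

Lemma fun_algebra_prod (I : Type) (s : seq I) (F : I -> T -> C) :
  (forall i, K (F i)) -> K (fun t => \prod_(i <- s) F i t).
Proof.
move=> KF; elim: s => [|i s IHs].
  by under eq_fun do rewrite big_nil; exact: (fun_algebra_cst hK).
by under eq_fun do rewrite big_cons; exact: (fun_algebraM hK).
Qed.

Lemma fun_algebra_det n (M : T -> 'M[C]_n) :
  (forall i j, K (fun t => M t i j)) -> K (fun t => \det (M t)).
Proof.
move=> KM; apply: fun_algebra_sum => s.
apply: (fun_algebraM hK); first exact: (fun_algebra_cst hK).
by apply: fun_algebra_prod => i; exact: KM.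
Qed.

End function_algebras.

(** The matrix of the Sylvester operator has entries linear in those of [A] and [B], so its
    determinant is a polynomial in them. *)
Lemma fun_algebra_sylvester (T : Type) (C : numClosedFieldType)
    (K : set (T -> C)) d (A B : T -> 'M[C]_d) : fun_algebra K ->
  (forall i j, K (fun t => A t i j)) -> (forall i j, K (fun t => B t i j)) ->
  K (fun t => sylvester (A t) (B t)).
Proof.
move=> hK KA KB; apply: (fun_algebra_det hK) => i j.
case/mxvec_indexP: j => p q.
pose E : 'M[C]_d := vec_mx (delta_mx 0 i).
have -> : (fun t => (lin_mulmx (A t) - lin_mulmxr (B t)) i (mxvec_index p q)) =
    (fun t => \sum_k A t p k * E k q - \sum_k E p k * B t k q).
  by apply/funext => t; rewrite !mxE /= !mxvecE !mxE.
apply: (fun_algebraD hK); last apply: (fun_algebraN hK).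
- apply: (fun_algebra_sum hK) => k; apply: (fun_algebraM hK) => //.
  exact: (fun_algebra_cst hK).
- apply: (fun_algebra_sum hK) => k; apply: (fun_algebraM hK) => //.
  exact: (fun_algebra_cst hK).
Qed.

Section complex_valued_functions.
Context {R : realType}.

Lemma ReD (x y : R[i]) : complex.Re (x + y) = complex.Re x + complex.Re y.
Proof. by case: x y => [? ?] []. Qed.
Lemma ImD (x y : R[i]) : complex.Im (x + y) = complex.Im x + complex.Im y.
Proof. by case: x y => [? ?] []. Qed.
Lemma ReM (x y : R[i]) : complex.Re (x * y) =
  complex.Re x * complex.Re y - complex.Im x * complex.Im y.
Proof. by case: x y => [? ?] []. Qed.
Lemma ImM (x y : R[i]) : complex.Im (x * y) =
  complex.Re x * complex.Im y + complex.Im x * complex.Re y.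
Proof. by case: x y => [? ?] []. Qed.

Definition cmeasurable d (T : measurableType d) (f : T -> R[i]) :=
  measurable_fun [set: T] (fun t => complex.Re (f t)) /\
  measurable_fun [set: T] (fun t => complex.Im (f t)).

Lemma cmeasurable_algebra d (T : measurableType d) :
  fun_algebra (@cmeasurable d T).
Proof.
split=> [c|f g [rf jf] [rg jg]|f g [rf jf] [rg jg]].
- by split; exact: measurable_cst.
- split; [under eq_fun do rewrite ReD|under eq_fun do rewrite ImD];
    exact: measurable_funD.
- split; [under eq_fun do rewrite ReM|under eq_fun do rewrite ImM].
    by apply: measurable_funB; exact: measurable_funM.
  by apply: measurable_funD; exact: measurable_funM.
Qed.

(* The point None carries the limit. *)
Definition ccvg (I : Type) (F : set_system I) (f : option I -> R[i]) :=
  complex.Re (f (Some i)) @[i --> F] --> complex.Re (f None) /\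
  complex.Im (f (Some i)) @[i --> F] --> complex.Im (f None).

Lemma ccvg_algebra (I : Type) (F : set_system I) : Filter F ->
  fun_algebra (ccvg F).
Proof.
move=> FF; split=> [c|f g [rf jf] [rg jg]|f g [rf jf] [rg jg]].
- by split; exact: cvg_cst.
- split; [under eq_fun do rewrite ReD|under eq_fun do rewrite ImD];
    by rewrite ?ReD ?ImD; exact: cvgD.
- split; [under eq_fun do rewrite ReM|under eq_fun do rewrite ImM];
    rewrite ?ReM ?ImM.
    by apply: cvgB; exact: cvgM.
  by apply: cvgD; exact: cvgM.
Qed.

Definition nsq (z : R[i]) : R := complex.Re z ^+ 2 + complex.Im z ^+ 2.

Lemma nsq_ge0 z : 0 <= nsq z.
Proof. by rewrite addr_ge0// sqr_ge0. Qed.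

Lemma nsq_eq0 z : (nsq z == 0) = (z == 0).
Proof. by rewrite paddr_eq0 ?sqr_ge0// !sqrf_eq0 eq_complex. Qed.

Lemma measurable_nsq d (T : measurableType d) (f : T -> R[i]) :
  cmeasurable f -> measurable_fun [set: T] (fun t => nsq (f t)).
Proof. by move=> [rf jf]; apply: measurable_funD; exact: measurable_funX. Qed.

Lemma cvg_nsq (I : Type) (F : set_system I) (f : option I -> R[i]) :
  Filter F -> ccvg F f -> nsq (f (Some i)) @[i --> F] --> nsq (f None).
Proof.
by move=> FF [rf jf]; rewrite /nsq !expr2; under eq_fun do rewrite !expr2;
  apply: cvgD; exact: cvgM.
Qed.

End complex_valued_functions.

Lemma product_measure_null {R : realType} d1 d2 (T1 : measurableType d1)
    (T2 : measurableType d2) (m1 : {sigma_finite_measure set T1 -> \bar R})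
    (m2 : {sigma_finite_measure set T2 -> \bar R}) (S : set (T1 * T2))
    (N : set T1) : measurable S -> m1.-negligible N ->
  (forall x, ~ N x -> m2 (xsection S x) = 0%E) -> (m1 \x m2)%E S = 0%E.
Proof.
move=> mS N0 S0; rewrite /product_measure1.
transitivity (\int[m1]_x (cst 0 x : \bar R))%E; last exact: integral0.
apply: ge0_ae_eq_integral => //.
- exact: measurable_fun_xsection.
- case: N0 => M [mM M0 NM]; exists M; split => // x /= /not_implyP[_ Sx].
  by apply: NM; apply: contrapT => /S0.
Qed.

Section separately_polynomial.
Context {R : realType}.

Definition tuple_upd n (a : n.-tuple R) (i : 'I_n) (s : R) : n.-tuple R :=
  [tuple if j == i then s else tnth a j | j < n].

(* Polynomial in each coordinate when the others are frozen; this much is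
   enough for the zero set to be null. *)
Definition sep_poly n (f : n.-tuple R -> R[i]) := forall a i,
  exists p : {poly R[i]}, forall s, f (tuple_upd a i s) = p.[s%:C].

Lemma sep_poly_algebra n : fun_algebra (@sep_poly n).
Proof.
split=> [c a i|f g pf pg a i|f g pf pg a i].
- by exists c%:P => s; rewrite hornerC.
- have [p fp] := pf a i; have [q gq] := pg a i.
  by exists (p + q) => s; rewrite hornerD fp gq.
- have [p fp] := pf a i; have [q gq] := pg a i.
  by exists (p * q) => s; rewrite hornerM fp gq.
Qed.

Lemma sep_poly_tnth n (k : 'I_n) : sep_poly (fun t => (tnth t k)%:C).
Proof.
move=> a i; have [->|ki] := eqVneq k i.
  by exists 'X => s; rewrite hornerX tnth_mktuple eqxx.
by exists ((tnth a k)%:C)%:P => s; rewrite hornerC tnth_mktuple (negbTE ki).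
Qed.

Lemma measurable_cmeasurable0 d (T : measurableType d) (f : T -> R[i]) :
  cmeasurable f -> measurable [set t | f t = 0].
Proof.
move=> mf; rewrite (_ : mkset _ = (fun t => nsq (f t)) @^-1` [set 0]).
  by rewrite -[X in measurable X]setTI; exact: measurable_nsq.
apply/seteqP; split => t /=; first by move=> ->; rewrite /nsq/= expr0n addr0.
by move=> /eqP; rewrite nsq_eq0 => /eqP.
Qed.

Lemma finite_poly_roots (p : {poly R[i]}) : p != 0 ->
  finite_set [set s : R | root p s%:C].
Proof.
move=> p0; have [r pr] := closed_field_poly_normal p.
apply: (@sub_finite_set _ _ [set` map (@complex.Re R) r]); last first.
  exact: finite_seq.
move=> s /=; rewrite pr rootZ ?lead_coef_eq0// root_prod_XsubC => sr.
by apply/mapP; exists s%:C.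
Qed.

(** Induction on [n]. With the tail frozen at that of [x0], [f] is a nonzero polynomial in the first
    coordinate; off its finitely many roots the slice is nonzero somewhere, hence has a null zero
    set, and Fubini concludes. *)
Lemma sep_poly_null n (f : n.-tuple R -> R[i]) (x0 : n.-tuple R) :
  cmeasurable f -> sep_poly f -> f x0 != 0 ->
  tuple_measure (@lebesgue_measure R) n [set t | f t = 0] = 0%E.
Proof.
elim: n f x0 => [|n IHn] f x0 mf pf fx0.
  by rewrite [x0]tuple0 in fx0 *; rewrite /= diracE memNset//= => /eqP; exact/negP.
have mZ := measurable_cmeasurable0 mf.
pose g (x : R) (t : n.-tuple R) := f (tuple_cons (x, t)).
have mg x : cmeasurable (g x).
  have mx : measurable_fun [set: n.-tuple R] (fun t => tuple_cons (x, t)).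
    apply: measurableT_comp; first exact: measurable_tuple_cons.
    by apply: measurable_fun_pair => //; exact: measurable_cst.
  case: mf => rf jf; split; first exact: (measurableT_comp rf mx).
  exact: (measurableT_comp jf mx).
have pg x : sep_poly (g x).
  move=> a i; have [p fp] := pf (tuple_cons (x, a)) (lift ord0 i).
  exists p => s; rewrite -fp; congr f; apply: eq_from_tnth => j.
  rewrite tnth_mktuple; case: (unliftP ord0 j) => [k ->|->].
    by rewrite !tnthS tnth_mktuple (inj_eq (@lift_inj _ _)).
  by rewrite !tnth0.
pose b := [tuple of behead x0].
have [p fp] := pf x0 ord0.
have gp x : g x b = p.[x%:C].
  rewrite -fp; congr f; apply: eq_from_tnth => j.
  rewrite tnth_mktuple; case: (unliftP ord0 j) => [k ->|->].
    rewrite tnthS tnth_behead /=; congr tnth; apply: val_inj.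
    by rewrite /= inordK// ltnS.
  by rewrite tnth0.
have p0 : p != 0.
  apply: contra fx0 => /eqP p0; have := gp (thead x0).
  by rewrite p0 horner0 => <-; rewrite /g /= {1}[x0]tuple_eta.
rewrite /= /tuple_measureS /pushforward.
have cZ := finite_set_countable (finite_poly_roots p0).
apply: (product_measure_null (m1 := @lebesgue_measure R)
  (m2 := tuple_measure (@lebesgue_measure R) n)
  (N := [set x : R | root p x%:C])).
- by rewrite -[X in measurable X]setTI; exact: measurable_tuple_cons.
- apply/negligibleP; first exact: countable_measurable.
  exact: countable_lebesgue_measure0.
- move=> x px; rewrite -(IHn (g x) b)//; last by rewrite gp; apply/negP.
  by congr (tuple_measure _ _ _); apply/seteqP; split => t /=;
    rewrite /xsection /= inE.
Qed.

End separately_polynomial.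

(** * Hermitian matrices in coordinates *)

Section herm_of.
Context {R : realType} {d : nat}.
Implicit Types (t : (d * d).-tuple R) (A B : 'M[R[i]]_d).

Lemma tnth_herm_coord A (i j : 'I_d) :
  tnth (herm_coord A) (mxvec_index i j) =
  if (i <= j)%N then complex.Re (A i j) else complex.Im (A j i).
Proof. by rewrite tnth_mktuple mxvecE mxE. Qed.

(** The inverse of [herm_coord] on Hermitian matrices: the imaginary part of an entry above the
    diagonal is read at the transposed position, with the opposite sign below the diagonal. *)
Definition herm_of t : 'M[R[i]]_d := \matrix_(i, j)
  if (i < j)%N then tnth t (mxvec_index i j) +i* tnth t (mxvec_index j i)
  else if (j < i)%N then
    tnth t (mxvec_index j i) +i* - tnth t (mxvec_index i j)
  else tnth t (mxvec_index i j) +i* 0.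

Lemma hermsymmxP A :
  reflect (forall i j, complex.Re (A i j) = complex.Re (A j i) /\
                       complex.Im (A i j) = - complex.Im (A j i))
          (A \is hermsymmx).
Proof.
apply: (iffP (is_hermitianmxP _ _ _)); rewrite expr0 scale1r.
  move=> AE i j; have := congr1 (fun M : 'M[R[i]]_d => M i j) AE.
  by rewrite !mxE; case: (A i j) (A j i) => [a b] [a' b'] /= [-> ->].
move=> AE; apply/matrixP => i j; rewrite !mxE.
by have := AE i j; case: (A i j) (A j i) => [a b] [a' b'] /= [-> ->].
Qed.

Lemma herm_ofK A : A \is hermsymmx -> herm_of (herm_coord A) = A.
Proof.
move=> /hermsymmxP hA; apply/matrixP => i j; rewrite mxE !tnth_herm_coord.
have [Rij Iij] := hA i j.
case: (ltngtP i j) => [ij|ji|/val_inj ij].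
- by case: (A i j).
- by rewrite -Iij -Rij; case: (A i j).
- move: Iij => /eqP; rewrite -ij -addr_eq0 -mulr2n mulrn_eq0 /= => /eqP.
  by case: (A i i) => a b /= ->.
Qed.

Lemma hermsymmxD A B : A \is hermsymmx -> B \is hermsymmx ->
  A + B \is hermsymmx.
Proof.
move=> /hermsymmxP hA /hermsymmxP hB; apply/hermsymmxP => i j.
have [RA IA] := hA i j; have [RB IB] := hB i j.
by rewrite !mxE !ReD !ImD RA RB IA IB opprD.
Qed.

Lemma hermsymmxN A : A \is hermsymmx -> - A \is hermsymmx.
Proof.
move=> /hermsymmxP hA; apply/hermsymmxP => i j.
have [RA IA] := hA i j; rewrite !mxE.
by move: RA IA; case: (A i j) (A j i) => [a b] [a' b'] /= -> ->.
Qed.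

Lemma fun_algebra_herm_of (T : Type) (K : set (T -> R[i]))
    (f : T -> (d * d).-tuple R) : fun_algebra K ->
  (forall k, K (fun u => (tnth (f u) k)%:C)) ->
  forall i j, K (fun u => herm_of (f u) i j).
Proof.
move=> hK Kf i j; under eq_fun do rewrite mxE.
have Krect a b : K (fun u => (a u)%:C) -> K (fun u => (b u)%:C) ->
    K (fun u => a u +i* b u).
  move=> Ka Kb.
  have -> : (fun u => a u +i* b u) = (fun u => (a u)%:C + 'i * (b u)%:C).
    by apply/funext => u; rewrite /=; simpc.
  by apply: (fun_algebraD hK) => //; apply: (fun_algebraM hK) => //;
    exact: (fun_algebra_cst hK).
case: (ltngtP i j) => _; apply: Krect => //.
- under eq_fun do rewrite rmorphN; exact: (fun_algebraN hK (Kf _)).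
- exact: (fun_algebra_cst hK).
Qed.

End herm_of.

(** * A real function detecting rank one perturbations that keep an eigenvalue *)

Section defect.
Context {R : realType} {d : nat}.
Implicit Types A B : 'M[R[i]]_d.

Definition minor2 B (p : 'I_d * 'I_d * ('I_d * 'I_d)) :=
  B p.1.1 p.1.2 * B p.2.1 p.2.2 - B p.1.1 p.2.2 * B p.2.1 p.1.2.

(* Vanishes exactly when B has rank at most one and A, A + B have a common
   eigenvalue. *)
Definition defect A B : R :=
  nsq (sylvester A (A + B)) + \sum_p nsq (minor2 B p).

(** The squared Frobenius norm, used to keep jumps away from zero and to bound eigenvalues. *)
Definition sqnorm B : R := \sum_p nsq (B p.1 p.2).

Lemma defect_eq0P A B : defect A B = 0 <->
  sylvester A (A + B) = 0 /\
  forall i j k l, B i j * B k l = B i l * B k j.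
Proof.
have s0 : 0 <= \sum_p nsq (minor2 B p) by apply: sumr_ge0 => p _; exact: nsq_ge0.
split.
  move=> /eqP; rewrite paddr_eq0 ?nsq_ge0// nsq_eq0 => /andP[/eqP -> /eqP m0].
  split=> // i j k l; apply/eqP; rewrite -subr_eq0 -nsq_eq0.
  have /(_ (i, j, (k, l)) isT) := psumr_eq0P (fun p _ => nsq_ge0 (minor2 B p)) m0.
  by move=> /= /eqP.
move=> [S0 minB]; apply/eqP; rewrite paddr_eq0 ?nsq_ge0// nsq_eq0 S0 eqxx /=.
apply/eqP; apply: big1 => p _; apply/eqP.
by rewrite nsq_eq0 /minor2 minB subrr.
Qed.

Lemma defect_ge0 A B : 0 <= defect A B.
Proof.
by rewrite addr_ge0 ?nsq_ge0//; apply: sumr_ge0 => p _; exact: nsq_ge0.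
Qed.

Lemma sqnorm_ge0 B : 0 <= sqnorm B.
Proof. by apply: sumr_ge0 => p _; exact: nsq_ge0. Qed.

Lemma sqnorm_eq0 B : (sqnorm B == 0) = (B == 0).
Proof.
apply/idP/eqP => [/eqP B0|->].
  apply/matrixP => i j; rewrite mxE; apply/eqP; rewrite -nsq_eq0.
  have /(_ (i, j) isT) := psumr_eq0P (fun p _ => nsq_ge0 (B p.1 p.2)) B0.
  by move=> /= /eqP.
by rewrite /sqnorm big1// => p _; apply/eqP; rewrite nsq_eq0 mxE.
Qed.

Lemma fun_algebra_add (T : Type) (K : set (T -> R[i])) (A B : T -> 'M[R[i]]_d) :
  fun_algebra K -> (forall i j, K (fun t => A t i j)) ->
  (forall i j, K (fun t => B t i j)) ->
  forall i j, K (fun t => (A t + B t) i j).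
Proof.
by move=> hK KA KB i j; under eq_fun do rewrite mxE; exact: (fun_algebraD hK).
Qed.

Lemma fun_algebra_minor2 (T : Type) (K : set (T -> R[i]))
  (B : T -> 'M[R[i]]_d) p : fun_algebra K -> (forall i j, K (fun t => B t i j)) ->
  K (fun t => minor2 (B t) p).
Proof.
move=> hK KB; apply: (fun_algebraD hK); last apply: (fun_algebraN hK);
  exact: (fun_algebraM hK).
Qed.

Lemma measurable_defect dT (T : measurableType dT) (A B : T -> 'M[R[i]]_d) :
  (forall i j, cmeasurable (fun t => A t i j)) ->
  (forall i j, cmeasurable (fun t => B t i j)) ->
  measurable_fun [set: T] (fun t => defect (A t) (B t)).
Proof.
move=> mA mB; have hK := @cmeasurable_algebra R _ T.
apply: measurable_funD; first apply: measurable_nsq.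
  apply: fun_algebra_sylvester => //; exact: fun_algebra_add.
apply: measurable_sum => p; apply/measurable_nsq; exact: fun_algebra_minor2.
Qed.

Lemma measurable_sqnorm dT (T : measurableType dT) (B : T -> 'M[R[i]]_d) :
  (forall i j, cmeasurable (fun t => B t i j)) ->
  measurable_fun [set: T] (fun t => sqnorm (B t)).
Proof. by move=> mB; apply: measurable_sum => p; exact: (measurable_nsq (mB _ _)). Qed.

Lemma cvg_defect (I : Type) (F : set_system I) (A B : option I -> 'M[R[i]]_d) :
  Filter F -> (forall i j, ccvg F (fun t => A t i j)) ->
  (forall i j, ccvg F (fun t => B t i j)) ->
  defect (A (Some i)) (B (Some i)) @[i --> F] --> defect (A None) (B None).
Proof.
move=> FF cA cB; have hK := @ccvg_algebra R _ _ FF.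
apply: cvgD; first apply: (cvg_nsq (f := fun t => sylvester (A t) (A t + B t)) FF).
  exact: (fun_algebra_sylvester hK cA (fun_algebra_add hK cA cB)).
apply: cvg_big => [|p _]; first exact: add_continuous.
exact: (cvg_nsq (f := fun t => minor2 (B t) p) FF) (fun_algebra_minor2 p hK cB).
Qed.

Lemma cvg_sqnorm (I : Type) (F : set_system I) (B : option I -> 'M[R[i]]_d) :
  Filter F -> (forall i j, ccvg F (fun t => B t i j)) ->
  sqnorm (B (Some i)) @[i --> F] --> sqnorm (B None).
Proof.
move=> FF cB; apply: cvg_big => [|p _]; first exact: add_continuous.
exact: (cvg_nsq (f := fun t => B t p.1 p.2) FF).
Qed.

Lemma cmeasurable_tnth n (k : 'I_n) :
  cmeasurable (fun t : n.-tuple R => (tnth t k)%:C).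
Proof. by split; [exact: measurable_tnth|exact: measurable_cst]. Qed.

(** If some two by two minor of [B] is nonzero, the set is empty. Otherwise it is the zero set of a
    polynomial in the coordinates, which is nonzero at [A0 - Y] for a matrix [A0] sharing no
    eigenvalue with [A0 + B]. *)
Lemma defect_null (Y B : 'M[R[i]]_d) : Y \is hermsymmx -> B \is hermsymmx ->
  B != 0 ->
  measurable [set x | defect (herm_of x + Y) B = 0] /\
  tuple_measure (@lebesgue_measure R) (d * d)
    [set x | defect (herm_of x + Y) B = 0] = 0%E.
Proof.
move=> hY hB B0.
pose f (x : (d * d).-tuple R) := sylvester (herm_of x + Y) (herm_of x + Y + B).
have Kf (K : set ((d * d).-tuple R -> R[i])) : fun_algebra K ->
    (forall k, K (fun x => (tnth x k)%:C)) -> K f.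
  move=> hK Kt; have Kx := fun_algebra_herm_of hK Kt.
  have Kc (M : 'M[R[i]]_d) i j : K (fun=> M i j) := fun_algebra_cst hK _.
  by apply: (fun_algebra_sylvester hK); do ![apply: (fun_algebra_add hK)|exact: Kc].
have [minB|minB] := pselect (forall i j k l, B i j * B k l = B i l * B k j).
  have -> : [set x | defect (herm_of x + Y) B = 0] = [set x | f x = 0].
    by apply/seteqP; split => x /=; rewrite defect_eq0P => // -[].
  have mf : cmeasurable f.
    by apply: Kf; [exact: cmeasurable_algebra|exact: cmeasurable_tnth].
  split; first exact: measurable_cmeasurable0.
  have [A0 hA0 fA0] := exists_sylvester_neq0 hB B0 minB.
  have pf : sep_poly f.
    by apply: Kf; [exact: sep_poly_algebra|exact: sep_poly_tnth].
  have fx0 : f (herm_coord (A0 - Y)) != 0.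
    have hK := herm_ofK (hermsymmxD hA0 (hermsymmxN hY)).
    by rewrite /f hK addrNK.
  exact: (sep_poly_null mf pf fx0).
rewrite (_ : mkset _ = set0) ?measure0//.
by apply/seteqP; split => x //= /defect_eq0P[].
Qed.

End defect.

(** * Independence of the past and a grid of increments *)

Section independence_extension.
Context {R : realType} {dO} {Omega : measurableType dO}.
Variable P : probability Omega R.

(** Both sides are finite measures in [F] with the same total mass; agreeing on the pi-system [G],
    they agree on the sigma-algebra it generates. *)
Lemma independent_sigma (A : set Omega) (G : set (set Omega)) :
  measurable A -> G `<=` measurable -> setI_closed G ->
  (forall F, G F -> P (A `&` F) = (P A * P F)%E) ->
  forall F, <<s G >> F -> P (A `&` F) = (P A * P F)%E.
Proof.
move=> mA Gm GI PG.
have PAfin : P A \is a fin_num := fin_num_measure P A mA.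
have PA0 : 0 <= fine (P A) by rewrite fine_ge0.
pose m2 := mscale (NngNum PA0) P.
have m2E F : m2 F = (P A * P F)%E by rewrite /m2 /mscale /= fineK.
have HE : [set F | G F /\ F `<=` setT] = G.
  by apply/seteqP; split => F /= => [[]|].
move=> F sF; rewrite setIC; transitivity (m2 F); last exact: m2E.
apply: (g_sigma_algebra_measure_unique_trace G setT measurableT _ _
  (mrestr P mA) m2); rewrite ?HE //.
- apply: etrans _ (esym (m2E _)); rewrite probability_setT mule1.
  by congr (P _); exact: setTI.
- move=> B GB; apply: etrans _ (esym (m2E _)); rewrite -PG//.
  by congr (P _); exact: setIC.
- by rewrite ltey_eq fin_num_measure.
Qed.

End independence_extension.

Section grid_sigma_algebra.
Context {R : realType} {dO dE} {Omega : measurableType dO}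
  {E : measurableType dE}.
Variables (P : probability Omega R) (Z : Omega -> E) (U : nat -> nat -> Omega -> E).
Hypothesis mZ : measurable_fun [set: Omega] Z.
Hypothesis mU : forall n k, measurable_fun [set: Omega] (U n k).
(** The past [Z] sits at index 0 and the [k]-th increment of level [n] at index [k+1]. *)
Hypothesis indU : forall n K, mutually_independent P
  (fun i : 'I_K.+1 => if i : nat is k.+1 then U n k else Z).

Definition boxes n : set (set Omega) := [set F | exists K (B : nat -> set E),
  (forall k, measurable (B k)) /\ F = \bigcap_(k in `I_K) (U n k @^-1` B k)].

Hypothesis refineU : forall n k B, measurable B ->
  <<s boxes n.+1 >> (U n k @^-1` B).

(** By [refineU] the sigma-algebras of the levels increase, so any two events lie in a common level
    and this union is a pi-system. *)
Definition grid_system : set (set Omega) := \bigcup_n <<s boxes n >>.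

Lemma boxesI n : setI_closed (boxes n).
Proof.
move=> _ _ [K1 [B1 [mB1 ->]]] [K2 [B2 [mB2 ->]]].
pose B k := (if (k < K1)%N then B1 k else setT) `&`
            (if (k < K2)%N then B2 k else setT).
exists (maxn K1 K2), B; split.
  by move=> k; apply: measurableI; case: ifP.
apply/seteqP; split => w /=.
  move=> [w1 w2] k _; split => /=; case: ifPn => //; [exact: w1|exact: w2].
move=> wB; split => k /= kK.
  have [|+ _] := wB k; first by rewrite /= leq_max kK.
  by rewrite /= kK.
have [|_] := wB k; first by rewrite /= leq_max kK orbT.
by rewrite /= kK.
Qed.

Lemma boxes_preimage n k B : measurable B -> boxes n (U n k @^-1` B).
Proof.
move=> mB; exists k.+1, (fun j => if j == k then B else setT); split.
  by move=> j; case: ifP.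
apply/seteqP; split => w /=.
  by move=> wB j /= _; case: eqP => // ->.
by move=> /(_ k (leqnn _)) /=; rewrite eqxx.
Qed.

Lemma boxes_measurable n : boxes n `<=` measurable.
Proof.
move=> _ [K [B [mB ->]]]; apply: fin_bigcap_measurable => // k _.
by rewrite -[X in measurable X]setTI; exact: mU.
Qed.

Lemma sub_sigma_boxes n : <<s boxes n >> `<=` <<s boxes n.+1 >>.
Proof.
apply: smallest_sub; first exact: smallest_sigma_algebra.
move=> _ [K [B [mB ->]]].
have /= := @fin_bigcap_measurable _ (g_sigma_algebraType (boxes n.+1)) _
  `I_K (fun k => U n k @^-1` B k) (finite_II K).
by apply=> k _; exact: refineU.
Qed.

Lemma grid_systemI : setI_closed grid_system.
Proof.
have le_boxes m n : (m <= n)%N -> <<s boxes m >> `<=` <<s boxes n >>.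
  move=> /subnK <-; elim: (n - m)%N => [//|k IHk].
  exact: subset_trans IHk (@sub_sigma_boxes _).
move=> F1 F2 [n1 _ F1n] [n2 _ F2n]; exists (maxn n1 n2) => //.
apply: (@measurableI _ (g_sigma_algebraType (boxes (maxn n1 n2)))).
  exact: (le_boxes _ _ (leq_maxl _ _)).
exact: (le_boxes _ _ (leq_maxr _ _)).
Qed.

Lemma grid_system_measurable : grid_system `<=` measurable.
Proof.
move=> F [n _]; apply: smallest_sub; last exact: boxes_measurable.
exact: sigma_algebra_measurable.
Qed.

Lemma grid_sigma_measurable : <<s grid_system >> `<=` measurable.
Proof.
apply: smallest_sub; last exact: grid_system_measurable.
exact: sigma_algebra_measurable.
Qed.

(** The pi-system argument is applied twice: from the boxes of one level to their sigma-algebra,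
    then from the union of the levels to the sigma-algebra it generates. *)
Lemma grid_independent A F : measurable A -> <<s grid_system >> F ->
  P (Z @^-1` A `&` F) = (P (Z @^-1` A) * P F)%E.
Proof.
move=> mA; have mZA : measurable (Z @^-1` A).
  by rewrite -[X in measurable X]setTI; exact: mZ.
have indbox n F' : boxes n F' -> P (Z @^-1` A `&` F') = (P (Z @^-1` A) * P F')%E.
  move=> [K [B [mB ->]]].
  (* Stated for every [A'], because [A' = setT] yields the product formula for the box alone. *)
  have key A' : measurable A' ->
      P (Z @^-1` A' `&` \bigcap_(k in `I_K) (U n k @^-1` B k)) =
      (P (Z @^-1` A') * \prod_(k < K) P (U n k @^-1` B k))%E.
    move=> mA'; pose B' (i : 'I_K.+1) := if i : nat is k.+1 then B k else A'.
    have mB' i : measurable (B' i) by rewrite /B'; case: (i : nat).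
    have := indU n mB'; rewrite big_ord_recl /= => <-.
    congr (P _); apply/seteqP; split => w /=.
      move=> [wA wB] i _ /=; case: (unliftP ord0 i) => [j ->|->] //=.
      by apply: wB => /=.
    move=> wB; split; first exact: (wB ord0).
    move=> k /= kK; exact: (wB (lift ord0 (Ordinal kK))).
  rewrite key//; congr (_ * _)%E.
  have := key setT measurableT.
  by rewrite preimage_setT setTI probability_setT mul1e.
move=> sF; apply: (independent_sigma mZA grid_system_measurable grid_systemI _ sF).
move=> F' [n _ F'n].
exact: (independent_sigma mZA (@boxes_measurable n) (@boxesI n) (indbox n)).
Qed.

Notation GO := (g_sigma_algebraType grid_system).

Lemma measurable_to_grid : measurable_fun [set: Omega] (idfun : Omega -> GO).
Proof. by move=> _ B mB; rewrite setTI; exact: grid_sigma_measurable. Qed.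

Lemma measurable_grid n k : measurable_fun [set: GO] (U n k : GO -> E).
Proof.
move=> _ B mB; rewrite setTI; apply: sub_sigma_algebra.
by exists n => //; apply: sub_sigma_algebra; exact: boxes_preimage.
Qed.

Lemma grid_product_null (S : set (GO * E)) (N : set Omega) : measurable S ->
  P.-negligible N ->
  (forall w, ~ N w -> P (Z @^-1` xsection S w) = 0%E) ->
  P [set w | S (w, Z w)] = 0%E.
Proof.
move=> mS N0 NS.
pose th (w : Omega) : GO * E := (w, Z w).
have mth : measurable_fun [set: Omega] th.
  by apply: measurable_fun_pair => //; exact: measurable_to_grid.
pose idG : {mfun Omega >-> GO} :=
  HB.pack (idfun : Omega -> GO) (isMeasurableFun.Build _ _ _ _ _ measurable_to_grid).
pose mfZ : {mfun Omega >-> E} := HB.pack Z (isMeasurableFun.Build _ _ _ _ _ mZ).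
pose mfth : {mfun Omega >-> (GO * E)%type} :=
  HB.pack th (isMeasurableFun.Build _ _ _ _ _ mth).
have prodE A B : measurable A -> measurable B ->
    distribution P mfth (A `*` B) = (distribution P idG A * distribution P mfZ B)%E.
  move=> mA mB; rewrite /distribution /pushforward /= muleC -grid_independent//.
  by rewrite setIC.
have -> : P [set w | S (w, Z w)] = distribution P mfth S by [].
rewrite -(product_measure_unique prodE mS).
have mX := measurable_fun_xsection (distribution P mfZ) mS.
(* The integral is moved back from [GO] to [Omega], where [N] is known to be negligible; the
   measurable null set covering [N] need not lie in the grid sigma-algebra. *)
rewrite /product_measure1 ge0_integral_distribution//.
transitivity (\int[P]_x (cst 0 x : \bar R))%E; last exact: integral0.
apply: ge0_ae_eq_integral => //.
  exact: (measurableT_comp mX measurable_to_grid).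
case: N0 => M [mM M0 NM]; exists M; split => // x /= /not_implyP[_ Sx].
by apply: NM; apply: contrapT => /NS.
Qed.

End grid_sigma_algebra.

(** * Cadlag paths and their jumps *)

Section cadlag_paths.
Context {R : realType} {d : nat}.
Implicit Types (x : R -> 'M[R[i]]_d) (t : R).

(** Packs a family with its limit into one function, so that convergence becomes an instance of
    [fun_algebra]. *)
Definition oseq I (M : I -> 'M[R[i]]_d) (L : 'M[R[i]]_d) (o : option I) :=
  if o is Some i then M i else L.

Definition mxcvg I (F : set_system I) (M : I -> 'M[R[i]]_d) (L : 'M[R[i]]_d) :=
  forall i j, ccvg F (fun o => oseq M L o i j).

Lemma mxcvg_map I (F : set_system I) (M : I -> 'M[R[i]]_d) (A B : 'M[R]_d) :
  Filter F ->
  map_mx (@complex.Re R) (M i) @[i --> F] --> A ->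
  map_mx (@complex.Im R) (M i) @[i --> F] --> B ->
  mxcvg F M (\matrix_(i, j) (A i j +i* B i j)).
Proof.
move=> FF RA IB i j.
have entry (f : R[i] -> R) (L : 'M[R]_d) : map_mx f (M k) @[k --> F] --> L ->
    f (M k i j) @[k --> F] --> L i j.
  move=> fL; have -> : (fun k => f (M k i j)) =
      (fun N : 'M[R]_d => N i j) \o (fun k => map_mx f (M k)).
    by apply/funext => k; rewrite /= mxE.
  exact: cvg_comp fL (@coord_continuous _ _ _ i j L).
by split; rewrite /= mxE; exact: entry.
Qed.

Lemma cadlag_left x t : cadlag_cmx x -> 0 < t ->
  mxcvg t^'- x (left_lim_cmx x t).
Proof.
by move=> [[_ Rx] [_ Ix]] t0; apply: mxcvg_map; [exact: Rx|exact: Ix].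
Qed.

Lemma cadlag_right x t : cadlag_cmx x -> 0 <= t -> mxcvg t^'+ x (x t).
Proof.
move=> [[Rx _] [Ix _]] t0.
have -> : x t = \matrix_(i, j) (map_mx (@complex.Re R) (x t) i j +i*
                                map_mx (@complex.Im R) (x t) i j).
  by apply/matrixP => i j; rewrite !mxE; case: (x t i j).
by apply: mxcvg_map; [exact: Rx|exact: Ix].
Qed.

Lemma mxcvg_comp I J (F : set_system I) (G : set_system J) (f : I -> J)
    (M : J -> 'M[R[i]]_d) (L : 'M[R[i]]_d) :
  f @ F --> G -> mxcvg G M L -> mxcvg F (M \o f) L.
Proof.
move=> fFG ML i j; have [RM IM] := ML i j; split.
- exact: cvg_comp fFG RM.
- exact: cvg_comp fFG IM.
Qed.

Lemma cadlag_seq_left I (F : set_system I) (s : I -> R) x t : Filter F ->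
  cadlag_cmx x -> 0 < t -> s @ F --> t -> (\forall i \near F, s i < t) ->
  mxcvg F (x \o s) (left_lim_cmx x t).
Proof.
move=> FF cx t0 st slt; apply: mxcvg_comp (cadlag_left cx t0).
move=> A tA; have := st _ tA; rewrite !nbhs_simpl /= => sA.
by apply: filterS2 slt sA => i slt; exact.
Qed.

Lemma cadlag_seq_right I (F : set_system I) (s : I -> R) x t : Filter F ->
  cadlag_cmx x -> 0 <= t -> s @ F --> t -> (\forall i \near F, t <= s i) ->
  mxcvg F (x \o s) (x t).
Proof.
move=> FF cx t0 st sge; have xt := cadlag_right cx t0.
have key (f : R -> R) : f r @[r --> t^'+] --> f t -> f (s i) @[i --> F] --> f t.
  move=> fr A fA; have := fr _ fA; rewrite !nbhs_simpl /= => tA.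
  have := st _ tA; rewrite !nbhs_simpl /= => sA.
  (* The right limit does not see [t] itself; where [s i = t], the value is exactly [f t]. *)
  apply: filterS2 sge sA => i; rewrite le_eqVlt => /predU1P[ts _|ts]; last exact.
  by rewrite /= -ts; exact: nbhs_singleton.
move=> i j; have [Rx Ix] := xt i j; split.
- exact: (key (fun r => complex.Re (x r i j))).
- exact: (key (fun r => complex.Im (x r i j))).
Qed.

Lemma mxcvgB I (F : set_system I) M1 M2 L1 L2 : Filter F ->
  mxcvg F M1 L1 -> mxcvg F M2 L2 -> mxcvg F (fun i : I => M1 i - M2 i) (L1 - L2).
Proof.
move=> FF c1 c2 i j; have hK := @ccvg_algebra R _ _ FF.
have -> : (fun o => oseq (fun i => M1 i - M2 i) (L1 - L2) o i j) =
    (fun o => oseq M1 L1 o i j - oseq M2 L2 o i j).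
  by apply/funext => -[k|]; rewrite /= !mxE.
by apply: (fun_algebraD hK) => //; exact: (fun_algebraN hK).
Qed.

Lemma mxcvgD I (F : set_system I) M1 M2 L1 L2 : Filter F ->
  mxcvg F M1 L1 -> mxcvg F M2 L2 -> mxcvg F (fun i : I => M1 i + M2 i) (L1 + L2).
Proof.
move=> FF c1 c2 i j; have hK := @ccvg_algebra R _ _ FF.
have -> : (fun o => oseq (fun i => M1 i + M2 i) (L1 + L2) o i j) =
    (fun o => oseq M1 L1 o i j + oseq M2 L2 o i j).
  by apply/funext => -[k|]; rewrite /= !mxE.
exact: (fun_algebraD hK).
Qed.

Lemma mxcvg_cst I (F : set_system I) (L : 'M[R[i]]_d) : Filter F ->
  mxcvg F (fun=> L) L.
Proof. by move=> FF i j; split; exact: cvg_cst. Qed.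

Lemma mxcvg_defect I (F : set_system I) M1 M2 L1 L2 : Filter F ->
  mxcvg F M1 L1 -> mxcvg F M2 L2 ->
  defect (M1 i) (M2 i) @[i --> F] --> defect L1 L2.
Proof. by move=> FF c1 c2; exact: (cvg_defect FF c1 c2). Qed.

Lemma mxcvg_sqnorm I (F : set_system I) M L : Filter F ->
  mxcvg F M L -> sqnorm (M i) @[i --> F] --> sqnorm L.
Proof. by move=> FF c; exact: (cvg_sqnorm FF c). Qed.

Definition dyadic (a : R) n k : R := a + k%:R / 2 ^+ n.

(* A substitute, involving only countably many times, for: some jump of x after
   a and up to about T, of squared norm at least delta, is a zero of defect. *)
Definition near_defect (a delta T : R) x (y : 'M[R[i]]_d) := forall m : nat,
  exists n0, forall n, (n0 <= n)%N -> exists k,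
  [/\ dyadic a n k <= T,
      delta <= sqnorm (x (dyadic a n k.+1) - x (dyadic a n k)) &
      defect (y + (x (dyadic a n k) - x a))
        (x (dyadic a n k.+1) - x (dyadic a n k)) <= m.+1%:R^-1].

Lemma dyadicS a n k : dyadic a n k.+1 = dyadic a n k + 2 ^- n.
Proof. by rewrite /dyadic -addrA -natr1 mulrDl mul1r. Qed.

Lemma dyadic_ge a n k : a <= dyadic a n k.
Proof. by rewrite lerDl divr_ge0// exprn_ge0. Qed.

Lemma cvg_dyadic_mesh : (2 ^- n : R) @[n --> \oo] --> (0 : R).
Proof.
under eq_cvg do rewrite -exprVn; apply: cvg_expr.
by rewrite ger0_norm ?invr_ge0// invf_lt1// ltr1n.
Qed.

(** Compactness: grid cells with increment at least [delta] and vanishing defect accumulate at some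
    [t] in [[a, T]]. They must straddle [t], so their increments converge to the jump there. *)
Lemma near_defect_jump a delta T x y : cadlag_cmx x -> 0 < a -> 0 < delta ->
  near_defect a delta T x y ->
  exists t, [/\ 0 < t, jump_cmx x t != 0 &
    defect (y + (left_lim_cmx x t - x a)) (jump_cmx x t) = 0].
Proof.
move=> cx a0 delta0 nd.
(* The [m]-th cell is taken at a level at least [m], so that the mesh vanishes. *)
have /choice[nk nkP] : forall m, exists p : nat * nat,
    (m <= p.1)%N /\ [/\ dyadic a p.1 p.2 <= T,
      delta <= sqnorm (x (dyadic a p.1 p.2.+1) - x (dyadic a p.1 p.2)) &
      defect (y + (x (dyadic a p.1 p.2) - x a))
        (x (dyadic a p.1 p.2.+1) - x (dyadic a p.1 p.2)) <= m.+1%:R^-1].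
  move=> m; have [n0 /(_ _ (leq_maxr m n0))[k kP]] := nd m.
  by exists (maxn m n0, k); split => //=; exact: leq_maxl.
(* The ultrafilter replaces extraction of subsequences: left endpoints converge along it, and it
   decides on which side of the limit each endpoint stays. *)
have [U [UU ooU]] := ultraFilterLemma eventually_filter.
have UP : ProperFilter U := @ultra_proper _ _ UU.
have UF : Filter U := @filter_filter _ _ UP.
pose s m := dyadic a (nk m).1 (nk m).2.
pose s' m := dyadic a (nk m).1 (nk m).2.+1.
have sT m : s m \in `[a, T].
  by have [_ [sT _ _]] := nkP m; rewrite in_itv /= dyadic_ge.
have [t [atT clt]] : `[a, T]%classic `&` cluster (s @ U) !=set0.
  apply: (@segment_compact R a T (s @ U) _).
  by apply: (@filterE _ U _ (s @^-1` `[a, T]%classic)) => m; exact: sT.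
have st : s @ U --> t.
  move=> A tA; rewrite nbhs_simpl /=.
  have [//|UA] := in_ultra_setVsetC (s @^-1` A) UU.
  by have [r []] := clt (~` A) A UA tA.
have mesh0 : 2 ^- (nk m).1 @[m --> U] --> (0 : R).
  have nkoo : (fun m => (nk m).1) @ U --> \oo.
    move=> A [N _ NA]; apply: ooU; exists N => // m /= Nm; apply: NA => /=.
    by have [mnk _] := nkP m; exact: leq_trans mnk.
  exact: cvg_comp nkoo cvg_dyadic_mesh.
have s't : s' @ U --> t.
  rewrite -[t]addr0; under eq_cvg do rewrite /s' dyadicS.
  exact: cvgD.
have ss' m : s m <= s' m by rewrite /s' dyadicS lerDl invr_ge0 exprn_ge0.
have [at_ tT] : a <= t /\ t <= T by move: atT; rewrite /= in_itv /= => /andP.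
have t0 : 0 < t := lt_le_trans a0 at_.
have lim2 L1 L2 : mxcvg U (x \o s) L1 -> mxcvg U (x \o s') L2 ->
    L2 - L1 != 0 /\ defect (y + (L1 - x a)) (L2 - L1) = 0.
  move=> c1 c2; have c21 := mxcvgB UF c2 c1.
  split.
    have cS := mxcvg_sqnorm UF c21.
    rewrite -sqnorm_eq0 gt_eqF//; apply: (lt_le_trans delta0).
    apply: (cvgr_to_ge cS).
    by apply: filterE => m; have [_ []] := nkP m.
  apply/eqP; rewrite eq_le defect_ge0 andbT.
  have cD := mxcvg_defect UF (mxcvgD UF (mxcvg_cst y UF)
    (mxcvgB UF c1 (mxcvg_cst (x a) UF))) c21.
  have inv0 : (m.+1%:R^-1 : R) @[m --> U] --> (0 : R).
    by apply: cvg_trans cvg_harmonic => A /ooU.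
  apply: (ler_cvg_to cD inv0).
  by apply: filterE => m; have [_ []] := nkP m.
have side (u : nat -> R) : u @ U --> t ->
    (\forall m \near U, u m < t) /\ mxcvg U (x \o u) (left_lim_cmx x t) \/
    (\forall m \near U, t <= u m) /\ mxcvg U (x \o u) (x t).
  move=> ut; have [lt_t|] := in_ultra_setVsetC [set m | u m < t] UU.
    by left; split=> //; exact: cadlag_seq_left.
  move=> nlt_t; right.
  have ge_t : \forall m \near U, t <= u m.
    by apply: filterS nlt_t => m /=; rewrite leNgt => /negP.
  by split=> //; exact: cadlag_seq_right (ltW t0) ut ge_t.
(* With both endpoints on one side the increments would tend to 0, against [delta]; a left endpoint
   after [t] with a right endpoint before it is absurd. Only straddling remains. *)
have [[_ c1]|[ge1 c1]] := side _ st; have [[lt2 c2]|[_ c2]] := side _ s't.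
- by have [] := lim2 _ _ c1 c2; rewrite subrr eqxx.
- by have [J0 D0] := lim2 _ _ c1 c2; exists t.
- have [m [ge1m lt2m]] := filter_ex (filterI ge1 lt2).
  by have := le_lt_trans (le_trans ge1m (ss' m)) lt2m; rewrite ltxx.
- by have [] := lim2 _ _ c1 c2; rewrite subrr eqxx.
Qed.

End cadlag_paths.

(** * Detection of jumps on dyadic grids, and their countability *)

Section jumps.
Context {R : realType} {d : nat}.
Implicit Types (x : R -> 'M[R[i]]_d) (t : R).

(** Cells are open on the left: the left endpoint has to stay strictly before [t] to see the left
    limit, while the right endpoint may equal [t]. *)
Lemma dyadic_bracket a n t : a < t ->
  exists k, dyadic a n k < t <= dyadic a n k.+1.
Proof.
move=> at_.
have e0 : 0 < 2 ^- n :> R by rewrite invr_gt0 exprn_gt0.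
have ex : exists k, t <= dyadic a n k.
  exists (Num.truncn ((t - a) * 2 ^+ n)).+1.
  by rewrite /dyadic -lerBlDl ler_pdivlMr ?exprn_gt0// ltW// truncnS_gt.
case: (ex_minnP ex) => -[|k] tk kmin.
  by move: tk; rewrite /dyadic mul0r addr0 leNgt at_.
exists k; rewrite tk andbT ltNge; apply/negP => /kmin.
by rewrite ltnn.
Qed.

(** Along the cells containing [t], the increments converge to the jump at [t] and the defects to 0.
    The strict bound on [delta] then survives for all fine enough levels. *)
Lemma jump_near_defect a delta T x y t : cadlag_cmx x -> 0 <= a -> a < t ->
  t <= T -> delta < sqnorm (jump_cmx x t) ->
  defect (y + (left_lim_cmx x t - x a)) (jump_cmx x t) = 0 ->
  near_defect a delta T x y.
Proof.
move=> cx a0 at_ tT delta_lt D0.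
have t0 : 0 < t := le_lt_trans a0 at_.
have /choice[k kP] := fun n => dyadic_bracket n at_.
pose s n := dyadic a n (k n); pose s' n := dyadic a n (k n).+1.
have s_lt n : s n < t by have /andP[] := kP n.
have s_ge n : t <= s' n by have /andP[] := kP n.
have meshE n : s' n = s n + 2 ^- n by rewrite /s' dyadicS.
have t_cst : (fun=> t : R) @ \oo --> t by exact: cvg_cst.
have st : s @ \oo --> t.
  apply: (squeeze_cvgr (f := fun n => t - 2 ^- n) (h := fun=> t)) => //.
    by near=> n; rewrite lerBlDr -meshE s_ge ltW.
  by rewrite -[X in _ --> X]subr0; apply: cvgB => //; exact: cvg_dyadic_mesh.
have s't : s' @ \oo --> t.
  rewrite -[t]addr0; under eq_cvg do rewrite meshE.
  by apply: cvgD => //; exact: cvg_dyadic_mesh.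
have F : Filter (\oo : set_system nat) by exact: filter_filter.
have c1 : mxcvg \oo (x \o s) (left_lim_cmx x t).
  by apply: cadlag_seq_left => //; exact: nearW.
have c2 : mxcvg \oo (x \o s') (x t).
  by apply: (cadlag_seq_right _ cx (ltW t0) s't); exact: nearW.
have c21 := mxcvgB F c2 c1.
have cS := mxcvg_sqnorm F c21.
have cD := mxcvg_defect F (mxcvgD F (mxcvg_cst y F)
  (mxcvgB F c1 (mxcvg_cst (x a) F))) c21.
rewrite D0 in cD; move=> m.
have near1 := cvgr_gt _ cS _ delta_lt.
have m0 : (0 : R) < m.+1%:R^-1 by rewrite invr_gt0.
have near2 := cvgr_lt _ cD _ m0.
have [N _ NP] := filterI (near1 F) (near2 F).
exists N => n Nn; exists (k n); have [/= d1 d2] := NP n Nn.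
by split; [exact: le_trans (ltW (s_lt n)) tT|exact: ltW|exact: ltW].
Unshelve. all: by end_near. Qed.

(** Code a jump time [t] by a rational [q < t] and an [m] such that, with [c = 1/(m+1)], the jump
    exceeds [3c] and [f] is within [c] of its left limit on []q, t[]. If [t1 < t2] shared a code,
    the value and the left limit at [t1] would both be within [c] of the left limit at [t2], so the
    jump at [t1] would be at most [2c]. *)
Lemma countable_left_jumps (V : normedModType R) (f : R -> V) :
  (forall t, 0 < t -> cvg (f s @[s --> t^'-])) ->
  countable [set t | 0 < t /\ f t <> lim (f s @[s --> t^'-])].
Proof.
move=> cf; set J := [set t | _].
pose L t := lim (f s @[s --> t^'-]).
have /choice[qm qmP] : forall t, exists qm : rat * nat, J t ->
    [/\ ratr qm.1 < t, 3 * qm.2.+1%:R^-1 < `|f t - L t| &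
     forall s, ratr qm.1 < s < t -> `|f s - L t| < qm.2.+1%:R^-1].
  move=> t; have [Jt|nJ] := pselect (J t); last by exists (0, 0%N).
  have [t0 /eqP ftL] := Jt.
  have jump0 : 0 < `|f t - L t| / 3 by rewrite divr_gt0// normr_gt0 subr_eq0.
  have [m mP] : exists m, m.+1%:R^-1 < `|f t - L t| / 3.
    by have /filter_ex[m mlt] := near_infty_natSinv_lt (PosNum jump0); exists m.
  have m0 : 0 < (m.+1%:R^-1 : R) by rewrite invr_gt0.
  have nearL : \forall s \near t^'-, `|f s - L t| < m.+1%:R^-1.
    exact: (cvgr_distC_lt _ _ (cf t t0) _ m0).
  have /nbhs_ballP[e /= e0 eP] := nearL.
  have [q] : exists q, ratr q \in `]t - e, t[ by apply: rat_in_itvoo; rewrite gtrBl.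
  rewrite in_itv /= => /andP[eq qt]; exists (q, m); split => //=.
    by rewrite mulrC -ltr_pdivlMr.
  move=> s /andP[qs st]; apply: eP => //.
  rewrite /ball /= ger0_norm ?subr_ge0 ?ltW// ltrBlDr -ltrBlDl.
  exact: lt_trans qs.
have noncross t1 t2 : J t1 -> J t2 -> qm t1 = qm t2 -> ~ t1 < t2.
  move=> /[dup] Jt1 [t10 _] Jt2 qm12 t12.
  have [q1 j1 _] := qmP _ Jt1; have [_ _ b2] := qmP _ Jt2.
  rewrite -qm12 in b2; set c := (qm t1).2.+1%:R^-1 in j1 b2.
  have c0 : 0 < c by rewrite invr_gt0.
  have f1 : `|f t1 - L t2| < c by apply: b2; rewrite q1 t12.
  have L1 : `|L t1 - L t2| <= c.
    have cL : `|f s - L t2| @[s --> t1^'-] --> `|L t1 - L t2|.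
      by apply: cvg_norm; apply: cvgB; [exact: cf|exact: cvg_cst].
    apply: (cvgr_to_le cL).
    near=> s; apply/ltW/b2; apply/andP; split.
      by near: s; exact: nbhs_left_gt.
    by apply: lt_trans t12; near: s; exact: nbhs_left_lt.
  have := lt_le_trans j1 (ler_distD (L t2) (f t1) (L t1)).
  by rewrite [`|L t2 - _|]distrC ltNge => /negP; apply; lra.
apply/countable_injP; exists (fun t => pickle (qm t)) => t1 t2.
move=> /set_mem Jt1 /set_mem Jt2 /(pcan_inj pickleK) qm12.
have [t12|t21|//] := ltgtP t1 t2.
- by have := noncross _ _ Jt1 Jt2 qm12 t12.
- by have := noncross _ _ Jt2 Jt1 (esym qm12) t21.
Unshelve. all: by end_near. Qed.

Lemma countable_jumps x : cadlag_cmx x ->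
  countable [set t | 0 < t /\ jump_cmx x t != 0].
Proof.
move=> [[_ cR] [_ cI]].
have := countable_left_jumps cR; have := countable_left_jumps cI.
set JI := mkset _; set JR := mkset _ => cJI cJR.
apply: (@sub_countable _ _ _ (\bigcup_(b in [set: bool]) if b then JI else JR)); last first.
  by apply: bigcup_countable => // -[].
apply: subset_card_le => t /= [t0 /eqP xt].
apply: contrapT => nJ.
have It : map_mx (@complex.Im R) (x t) = lim (map_mx (@complex.Im R) (x s) @[s --> t^'-]).
  by apply: contrapT => It; apply: nJ; exists true.
have Rt : map_mx (@complex.Re R) (x t) = lim (map_mx (@complex.Re R) (x s) @[s --> t^'-]).
  by apply: contrapT => Rt; apply: nJ; exists false.
apply: xt; rewrite /jump_cmx; apply/matrixP => i j; rewrite !mxE -It -Rt !mxE.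
by case: (x t i j) => u v; rewrite subrr.
Qed.

End jumps.

(** * Continuity of the ordered eigenvalues *)

Section eigenvalues.
Context {R : realType} {d : nat}.
Implicit Types A B : 'M[R[i]]_d.
Local Open Scope sesquilinear_scope.

Lemma root_eigvals A (i : 'I_d) : A \is hermsymmx ->
  root (char_poly A) (eigvals A ord0 i)%:C.
Proof.
move=> hA; rewrite char_poly_eigvals// /root horner_prod.
by apply/prodf_eq0; exists i => //; rewrite hornerXsubC subrr.
Qed.

(** The trace of [A *m A] is both the squared Frobenius norm and the sum of the squared
    eigenvalues. *)
Lemma eigvals_sq_le A (i : 'I_d) : A \is hermsymmx ->
  eigvals A ord0 i ^+ 2 <= sqnorm A.
Proof.
move=> hA; have /orthomx_spectralP AE := hermitian_normalmx hA.
have /mxOverP dreal := hermitian_spectral_diag_real hA.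
pose r j := complex.Re (spectral_diag A ord0 j).
have rE j : spectral_diag A ord0 j = (r j)%:C by rewrite /r RRe_real.
have [j ->] : exists j, eigvals A ord0 i = r j.
  rewrite mxE; set s := sort _ _.
  have : nth 0 s i \in s.
    by apply: mem_nth; rewrite size_sort size_map size_enum_ord.
  by rewrite mem_sort => /mapP[j _ ->]; exists j.
have -> : sqnorm A = \sum_j r j ^+ 2.
  apply: (@complexI R); rewrite [RHS]rmorph_sum /=.
  transitivity (\tr (A *m A)).
    have -> : sqnorm A = \sum_p \sum_q nsq (A p q) by rewrite pair_bigA.
    rewrite rmorph_sum /=.
    apply: eq_bigr => p _; rewrite !mxE rmorph_sum; apply: eq_bigr => q _.
    have /hermsymmxP/(_ q p)[Rqp Iqp] := hA.
    rewrite /nsq; move: Rqp Iqp; case: (A p q) (A q p) => [a b] [a' b'] /= -> ->.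
    by simpc; congr (_ +i* _); ring.
  rewrite {1 2}AE; set S := spectralmx A; set D := diag_mx _.
  have uS : S \in unitmx := spectral_unit A.
  rewrite -!mulmxA (mulmxA S) mulmxV// mul1mx mxtrace_mulC -!mulmxA mulmxV//.
  rewrite mulmx1 mulmx_diag mxtrace_diag; apply: eq_bigr => k _.
  by rewrite mxE rE -rmorphM expr2.
by rewrite (bigD1 j)//= lerDl sumr_ge0// => k _; exact: sqr_ge0.
Qed.

Lemma char_poly_horner A (z : R) : A \is hermsymmx ->
  complex.Re (\det (z%:C%:M - A)) = \prod_i (z - eigvals A ord0 i).
Proof.
move=> hA; have -> : \det (z%:C%:M - A) = (char_poly A).[z%:C].
  rewrite /char_poly -[RHS]/(horner_eval z%:C _) -det_map_mx; congr (\det _).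
  apply/matrixP => i j; rewrite !mxE /= /horner_eval hornerD hornerN hornerC.
  by rewrite hornerMn hornerX.
rewrite char_poly_eigvals// horner_prod.
have -> : \prod_i ('X - ((eigvals A ord0 i)%:C)%:P).[z%:C] =
    (\prod_i (z - eigvals A ord0 i))%:C.
  by rewrite rmorph_prod; apply: eq_bigr => i _; rewrite hornerXsubC rmorphB.
by [].
Qed.

(** The two monic polynomials agree at more points than their difference can have roots, so they
    have the same roots with multiplicity; sorting fixes the order. *)
Lemma sorted_roots_inj (u v : 'rV[R]_d) :
  (forall i j : 'I_d, (i <= j)%N -> u ord0 j <= u ord0 i) ->
  (forall i j : 'I_d, (i <= j)%N -> v ord0 j <= v ord0 i) ->
  (forall z, \prod_i (z - u ord0 i) = \prod_i (z - v ord0 i)) -> u = v.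
Proof.
move=> su sv uv.
pose l (w : 'rV[R]_d) := [seq w ord0 i | i <- enum 'I_d].
have sorted_l (w : 'rV[R]_d) : (forall i j : 'I_d, (i <= j)%N -> w ord0 j <= w ord0 i) ->
    sorted >=%R (l w).
  move=> sw; apply: (@homo_sorted _ _ _ (fun i j : 'I_d => (i <= j)%N)) => //.
  have := iota_sorted 0 d; rewrite -val_enum_ord sorted_map.
  by [].
pose p (w : 'rV[R]_d) : {poly R} := \prod_(a <- l w) ('X - a%:P).
have pE (w : 'rV[R]_d) z : (p w).[z] = \prod_i (z - w ord0 i).
  rewrite /p /l big_map big_enum horner_prod.
  by apply: eq_bigr => i _; rewrite hornerXsubC.
have puv : p u = p v.
  apply/eqP; rewrite -subr_eq0; apply/eqP.
  pose rs : seq R := [seq k%:R | k <- iota 0 (size (p u - p v)).+1].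
  apply: (@roots_geq_poly_eq0 _ _ rs).
  - by apply/allP => z _; rewrite /root hornerD hornerN !pE uv subrr.
  - by rewrite map_inj_uniq ?iota_uniq// => a b /eqP; rewrite eqr_nat => /eqP.
  - by rewrite size_map size_iota.
have luv : l u = l v.
  apply: (@sorted_eq _ >=%R).
  - by move=> a b c /= ba cb; exact: le_trans cb ba.
  - by move=> a b /andP[ba ab]; apply/le_anti/andP.
  - exact: sorted_l.
  - exact: sorted_l.
  - exact: prod_XsubC_eq.
apply/rowP => i; have /eq_in_map/(_ i) := luv.
by rewrite mem_enum => ->.
Qed.

End eigenvalues.

Section eigenvalue_continuity.
Context {R : realType} {d : nat}.

Lemma mxcvg_hermsymmx I (F : set_system I) (M : I -> 'M[R[i]]_d) L :
  ProperFilter F -> mxcvg F M L -> (\forall k \near F, M k \is hermsymmx) ->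
  L \is hermsymmx.
Proof.
move=> FF cL hM; apply/hermsymmxP => i j.
have F0 : Filter F by exact: filter_filter.
have lim_eq (f g : I -> R) (l m : R) : f k @[k --> F] --> l -> g k @[k --> F] --> m ->
    (\forall k \near F, f k = g k) -> l = m.
  move=> fl gm fg; apply: (@cvg_unique _ (@Rhausdorff R) (f @ F) _ l m fl).
  have gf : \forall k \near F, g k = f k by apply: filterS fg => k ->.
  exact: cvg_trans (@near_eq_cvg _ _ F F0 _ _ gf) gm.
have [Rij Iij] := cL i j; have [Rji Iji] := cL j i.
split.
- apply: (lim_eq _ _ _ _ Rij Rji).
  by apply: filterS hM => k /hermsymmxP/(_ i j)[].
- apply: (lim_eq _ _ _ _ Iij (cvgN Iji)).
  by apply: filterS hM => k /hermsymmxP/(_ i j)[].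
Qed.

(** The eigenvalue vectors eventually stay in a compact box. By continuity of the determinant, any
    cluster point is a sorted vector of roots of the characteristic polynomial of [L], hence is
    [eigvals L]. *)
Lemma cvg_eigvals I (F : set_system I) (M : I -> 'M[R[i]]_d) L :
  ProperFilter F -> mxcvg F M L -> (\forall k \near F, M k \is hermsymmx) ->
  eigvals (M k) @[k --> F] --> eigvals L.
Proof.
move=> FF cL hM; have hL := mxcvg_hermsymmx FF cL hM.
have F0 : Filter F by exact: filter_filter.
have cS := mxcvg_sqnorm F0 cL.
(* This leaves room for the eigenvalues of nearby [M k], whose squares are below [sqnorm L + 1], and
   for the unit ball around [eigvals L]. *)
pose r := sqnorm L + 2.
pose V := [set v : 'rV[R]_d | forall i, `[- r, r]%classic (v ord0 i)].
have L0 : 0 <= sqnorm L := sqnorm_ge0 L.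
have cV : compact V.
  by apply: (@rV_compact R d (fun=> `[- r, r]%classic)) => i; exact: segment_compact.
have FV : (eigvals \o M @ F) V.
  have SL : \forall k \near F, sqnorm (M k) < sqnorm L + 1.
    have S1 : sqnorm L < sqnorm L + 1 by rewrite ltrDl.
    exact: (cvgr_lt _ cS _ S1).
  apply: filterS2 hM SL => k hMk Sk i /=.
  have := eigvals_sq_le i hMk; rewrite in_itv /= -ler_norml -real_normK ?num_real//.
  by rewrite /r; have := normr_ge0 (eigvals (M k) ord0 i); nra.
have nV : nbhs (eigvals L) V.
  apply/nbhs_ballP; exists 1 => //= v Lv i.
  have := eigvals_sq_le i hL; have [_ /(_ ord0 i)] := Lv.
  rewrite -real_normK ?num_real// /= in_itv /= -ler_norml.
  rewrite -ball_normE /= => Lvi Li.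
  have := ler_distD (eigvals L ord0 i) (v ord0 i) 0.
  rewrite !subr0 [`|v _ _ - _|]distrC.
  by move: Li Lvi; rewrite /r; have := normr_ge0 (eigvals L ord0 i); nra.
have clE v : cluster (eigvals \o M @ F) v -> v = eigvals L.
  (* A cluster point is a limit along a finer proper filter [G], which inherits everything known
     along [F]. *)
  rewrite cluster_cvgE => -[G PG [Gv FG]].
  have G0 : Filter G by exact: filter_filter.
  have cv i : w ord0 i @[w --> G] --> v ord0 i.
    exact: cvg_comp Gv (@coord_continuous _ _ _ ord0 i v).
  apply: sorted_roots_inj.
  - move=> i j ij; apply: (ler_cvg_to (cv j) (cv i)); apply: FG.
    by apply: nearW => k /=; exact: eigvals_sorted.
  - by move=> i j ij; exact: eigvals_sorted.
  move=> z; rewrite -char_poly_horner//.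
  pose phi (w : 'rV[R]_d) := \prod_i (z - w ord0 i).
  have phiv : phi w @[w --> G] --> phi v.
    apply: cvg_big => [|i _]; first exact: mul_continuous.
    apply: cvgB; last exact: cv.
    exact: (cvg_cst z (FF := G0)).
  apply: (@cvg_unique _ (@Rhausdorff R) (phi @ G) _ _ _ phiv).
  have : phi (eigvals (M k)) @[k --> F] --> complex.Re (\det (z%:C%:M - L)).
    have hK := @ccvg_algebra R _ _ F0.
    have [+ _] : ccvg F (fun o => \det (z%:C%:M - oseq M L o)).
      apply: (fun_algebra_det hK) => i j; under eq_fun do rewrite !mxE.
      apply: (fun_algebraD hK); first exact: (fun_algebra_cst hK).
      exact: (fun_algebraN hK (cL i j)).
    apply: cvg_trans; apply: (@near_eq_cvg _ _ F F0).
    by apply: filterS hM => k hMk /=; rewrite char_poly_horner.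
  by move=> phiL A /phiL phiA; apply: FG.
have PFe : ProperFilter (eigvals \o M @ F) by exact: fmap_proper_filter.
apply: (@compact_cluster_set1 _ _ (eigvals \o M @ F) V _ cV nV PFe FV).
  exact: norm_hausdorff.
apply/seteqP; split => [v /clE ->//|_ ->].
have [v [_ clv]] := cV _ _ FV.
by rewrite -(clE _ clv).
Qed.

Lemma jump_eigvalsE (x : R -> 'M[R[i]]_d) t : cadlag_cmx x ->
  (forall s, 0 <= s -> x s \is hermsymmx) -> 0 < t ->
  left_lim_cmx x t \is hermsymmx /\
  jump_eigvals x t = eigvals (x t) - eigvals (left_lim_cmx x t).
Proof.
move=> cx hx t0.
have hx' : \forall s \near t^'-, x s \is hermsymmx.
  by near=> s; apply: hx; near: s; exact: nbhs_left_ge.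
have cl := cadlag_left cx t0.
split; first exact: mxcvg_hermsymmx cl hx'.
rewrite /jump_eigvals; congr (_ - _); apply: cvg_lim; first exact: norm_hausdorff.
exact: cvg_eigvals cl hx'.
Unshelve. all: by end_near. Qed.

(** An ordered eigenvalue that stays put is a common root of the characteristic polynomials before
    and after the jump. *)
Lemma jump_eigvals_neq0 (x : R -> 'M[R[i]]_d) t (i : 'I_d) : cadlag_cmx x ->
  (forall s, 0 <= s -> x s \is hermsymmx) -> 0 < t ->
  sylvester (left_lim_cmx x t) (left_lim_cmx x t + jump_cmx x t) != 0 ->
  jump_eigvals x t ord0 i != 0.
Proof.
move=> cx hx t0; have [hl ->] := jump_eigvalsE cx hx t0.
apply: contra; rewrite mxE [X in _ + X]mxE subr_eq0 => /eqP e.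
rewrite /jump_cmx addrC subrK; apply/eqP.
apply: (sylvester_common_root (root_eigvals i hl)).
by rewrite -e; apply: root_eigvals; exact: hx (ltW t0).
Qed.

End eigenvalue_continuity.

(** * Levy processes *)

Section levy_increments.
Context {R : realType} {dO : measure_display} {Omega : measurableType dO}.
Variables (P : probability Omega R) (d : nat).
Variable X : R -> Omega -> 'M[R[i]]_d.
Hypothesis levyX : hermitian_levy_process P X.
Hypothesis acX : absolutely_continuous_process P X.
Variable a : R.
Hypothesis a0 : 0 < a.

Local Notation E := ((d * d).-tuple R).
Local Notation Z := (incr X 0 a).
Local Notation U := (fun n k => incr X (dyadic a n k) (dyadic a n k.+1)).
Local Notation GO := (g_sigma_algebraType (grid_system U)).

Lemma tnth_herm_coordB (A B : 'M[R[i]]_d) k :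
  tnth (herm_coord (A - B)) k = tnth (herm_coord A) k - tnth (herm_coord B) k.
Proof.
case/mxvec_indexP: k => i j; rewrite !tnth_herm_coord !mxE.
by case: ifP => _; rewrite ?ReD ?ImD; case: (B _ _).
Qed.

Lemma tnth_incr s t w k : tnth (incr X s t w) k =
  tnth (herm_coord (X t w)) k - tnth (herm_coord (X s w)) k.
Proof. exact: tnth_herm_coordB. Qed.

Lemma measurable_incr s t : 0 <= s -> 0 <= t ->
  measurable_fun [set: Omega] (incr X s t).
Proof.
move=> s0 t0; apply/measurable_fun_tnthP => k.
rewrite (_ : _ \o _ = fun w => tnth (herm_coord (X t w)) k -
                               tnth (herm_coord (X s w)) k); last first.
  by apply/funext => w; exact: tnth_incr.
by apply: measurable_funB; apply: (measurableT_comp (measurable_tnth k));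
  exact: (levy_measurable levyX).
Qed.

Lemma incr_cat r s t w k :
  tnth (incr X r t w) k = tnth (incr X r s w) k + tnth (incr X s t w) k.
Proof. by rewrite !tnth_incr [RHS]addrC addrA subrK. Qed.

Lemma herm_of_incr s t w : 0 <= s -> 0 <= t ->
  herm_of (incr X s t w) = X t w - X s w.
Proof.
move=> s0 t0; apply: herm_ofK; apply: hermsymmxD; last apply: hermsymmxN;
  exact: (levy_hermitian levyX).
Qed.

Lemma dyadic_ge0 n k : 0 <= dyadic a n k.
Proof. exact: le_trans (ltW a0) (dyadic_ge a n k). Qed.

Lemma measurable_U n k : measurable_fun [set: Omega] (U n k).
Proof. by apply: measurable_incr; exact: dyadic_ge0. Qed.

Lemma measurable_Z : measurable_fun [set: Omega] Z.
Proof. by apply: measurable_incr => //; exact: ltW. Qed.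

Lemma independent_U n K : mutually_independent P
  (fun i : 'I_K.+1 => if i : nat is k.+1 then U n k else Z).
Proof.
(* The times 0, [a], then the grid after [a]: the first increment is [Z]. *)
pose t (j : nat) := if j is k.+1 then dyadic a n k else 0.
have t0 : 0 <= t 0%N by [].
have tS k : t k <= t k.+1.
  case: k => [|k] /=; first exact: dyadic_ge0.
  by rewrite dyadicS lerDl invr_ge0 exprn_ge0.
have := @levy_independent _ _ _ _ _ _ levyX K.+1 t t0 tS.
congr (mutually_independent P _); apply/funext => -[[|k] kK] //=.
by rewrite /dyadic mul0r addr0.
Qed.

(** An increment of level [n] is the sum of two consecutive increments of level [n+1]. *)
Lemma refine_U n k B : measurable B -> <<s boxes U n.+1 >> (U n k @^-1` B).
Proof.
move=> mB.
have dyE j : dyadic a n.+1 j.*2 = dyadic a n j.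
  rewrite /dyadic -muln2 natrM exprS invfM mulrA -[_ * 2 / 2]mulrA.
  by rewrite divff ?mulr1// pnatr_eq0.
have mS j : measurable_fun [set: g_sigma_algebraType (boxes U n.+1)] (U n.+1 j).
  move=> _ C mC; rewrite setTI; apply: sub_sigma_algebra.
  exact: (boxes_preimage U).
suff : measurable_fun [set: g_sigma_algebraType (boxes U n.+1)] (U n k).
  by move=> /(_ measurableT _ mB); rewrite setTI.
apply/measurable_fun_tnthP => i.
rewrite (_ : _ \o _ = fun w => tnth (U n.+1 k.*2 w) i + tnth (U n.+1 k.*2.+1 w) i).
  by apply: measurable_funD; apply: measurableT_comp (measurable_tnth i) (mS _).
by apply/funext => w /=; rewrite -incr_cat -doubleS !dyE.
Qed.

Lemma measurable_grid_incr n k :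
  measurable_fun [set: GO] (incr X a (dyadic a n k)).
Proof.
apply/measurable_fun_tnthP => i; elim: k => [|k IHk].
  rewrite (_ : _ \o _ = cst 0); first exact: measurable_cst.
  by apply/funext => w; rewrite /= tnth_incr /dyadic mul0r addr0 subrr.
rewrite (_ : _ \o _ = fun w => tnth (incr X a (dyadic a n k) w) i +
                               tnth (U n k w) i); last first.
  by apply/funext => w /=; exact: incr_cat.
apply: measurable_funD; first exact: IHk.
apply: (measurableT_comp (measurable_tnth i)).
exact: (@measurable_grid _ _ _ _ U n k).
Qed.

(** The quantifiers of [near_defect] range over integers, and the path enters only through
    increments after [a], which are measurable on [GO]. *)
Lemma measurable_near_defect delta T :
  measurable [set p : GO * E | near_defect a delta T (X ^~ p.1) (herm_of p.2)].
Proof.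
pose D n k (p : GO * E) :=
  X (dyadic a n k.+1) p.1 - X (dyadic a n k) p.1.
pose Y n k (p : GO * E) :=
  herm_of p.2 + (X (dyadic a n k) p.1 - X a p.1).
pose S m n k : set (GO * E) := [set p | dyadic a n k <= T] `&`
  ([set p | delta <= sqnorm (D n k p)] `&`
   [set p | defect (Y n k p) (D n k p) <= m.+1%:R^-1]).
have -> : [set p : GO * E | near_defect a delta T (X ^~ p.1) (herm_of p.2)] =
    \bigcap_m \bigcup_n0 \bigcap_(n in [set n | (n0 <= n)%N]) \bigcup_k S m n k.
  apply/seteqP; split => p /=.
    move=> pS m _; have [n0 n0P] := pS m; exists n0 => // n /= n0n.
    by have [k [? ? ?]] := n0P n n0n; exists k.
  move=> pS m; have [n0 _ n0P] := pS m I; exists n0 => n n0n.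
  by have [k _ [? [? ?]]] := n0P n n0n; exists k.
have hK := @cmeasurable_algebra R _ (GO * E)%type.
have mherm (f : GO * E -> E) : measurable_fun setT f ->
    forall i j, cmeasurable (fun p => herm_of (f p) i j).
  move=> mf; apply: (fun_algebra_herm_of hK) => k; split.
    exact: (measurableT_comp (measurable_tnth k) mf).
  exact: measurable_cst.
have mfst (f : GO -> E) : measurable_fun setT f ->
    measurable_fun setT (fun p : GO * E => f p.1).
  by move=> mf; exact: (measurableT_comp mf measurable_fst).
have mD n k i j : cmeasurable (fun p => D n k p i j).
  rewrite (_ : (fun p => _) = (fun p => herm_of (U n k p.1) i j)).
    by apply: mherm; apply: (mfst (U n k)); exact: (@measurable_grid _ _ _ _ U n k).
  by apply/funext => p; rewrite herm_of_incr// dyadic_ge0.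
have mY n k i j : cmeasurable (fun p => Y n k p i j).
  apply: (fun_algebra_add hK); first exact: mherm measurable_snd.
  move=> i' j'.
  rewrite (_ : (fun p => _) = (fun p => herm_of (incr X a (dyadic a n k) p.1) i' j')).
    by apply: mherm; apply: mfst; exact: measurable_grid_incr.
  by apply/funext => p; rewrite herm_of_incr// ?dyadic_ge0// ltW.
apply: bigcapT_measurable => m; apply: bigcupT_measurable => n0.
apply: bigcap_measurable => [|n _]; first by exists n0 => /=.
apply: bigcupT_measurable => k; apply: measurableI.
  by have [dT|dT] := boolP (dyadic a n k <= T);
    [rewrite (_ : mkset _ = setT)//|rewrite (_ : mkset _ = set0)//];
    apply/seteqP; split.
apply: measurableI.
  rewrite -[X in measurable X]setTI.
  exact: (measurable_fun_le measurableT (measurable_cst _) (measurable_sqnorm (mD n k))).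
rewrite -[X in measurable X]setTI.
exact: (measurable_fun_le measurableT (measurable_defect (mY n k) (mD n k)) (measurable_cst _)).
Qed.

(** The path [w] fixes the shift and the jump; [w'] enters only through [Z], which almost surely
    gives the coordinates of [X a]. Absolute continuity transfers the Lebesgue null set of
    [defect_null]. *)
Lemma defect_section_null w t : cadlag_cmx (X ^~ w) -> 0 < t ->
  jump_cmx (X ^~ w) t != 0 ->
  P.-negligible [set w' | defect
    (herm_of (Z w') + (left_lim_cmx (X ^~ w) t - X a w)) (jump_cmx (X ^~ w) t) = 0].
Proof.
move=> cw t0 J0.
have hX s : 0 <= s -> X s w \is hermsymmx by move=> s0; exact: (levy_hermitian levyX).
have [hL _] := jump_eigvalsE cw hX t0.
have hY : left_lim_cmx (X ^~ w) t - X a w \is hermsymmx.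
  exact: hermsymmxD hL (hermsymmxN (hX _ (ltW a0))).
have hJ : jump_cmx (X ^~ w) t \is hermsymmx.
  by apply: hermsymmxD; [exact: hX (ltW t0)|exact: hermsymmxN].
have [mD D0] := defect_null hY hJ J0.
set D := mkset _ in mD D0.
have PD : P ((fun w' => herm_coord (X a w')) @^-1` D) = 0%E.
  by have /null_content_dominatesP/(_ D mD D0) := acX a0.
have ND : P.-negligible ((fun w' => herm_coord (X a w')) @^-1` D).
  apply/negligibleP; last exact: PD.
  have := levy_measurable levyX (ltW a0) measurableT mD.
  by move=> mXD; rewrite setTI in mXD.
apply: negligibleS (negligibleU ND (levy_start levyX)) => w' /= Dw'.
have [X0|X0] := pselect (X 0 w' = 0); last by right.
by left; rewrite /D /=; move: Dw'; rewrite /incr X0 subr0.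
Qed.

(** For a fixed cadlag path, the section lies in a union over its countably many jump times of
    negligible sets; independence of [Z] from the grid then gives a null event. *)
Lemma near_defect_null delta T : 0 < delta ->
  {ae P, forall w, ~ near_defect a delta T (X ^~ w) (herm_of (Z w))}.
Proof.
move=> delta0; pose S := [set p : GO * E |
  near_defect a delta T (X ^~ p.1) (herm_of p.2)].
have mS : measurable S := measurable_near_defect delta T.
suff : P.-negligible [set w | S (w, Z w)].
  by apply: negligibleS => w /= /contrapT.
have mth : measurable_fun [set: Omega] (fun w => (w, Z w) : GO * E).
  apply: measurable_fun_pair; last exact: measurable_Z.
  exact: (@measurable_to_grid _ _ _ _ U measurable_U).
apply/negligibleP; first by rewrite -[X in measurable X]setTI; exact: mth.
apply: (grid_product_null measurable_Z measurable_U independent_U refine_U mS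
  (levy_cadlag levyX)).
move=> w /contrapT cw.
have mSw : measurable (Z @^-1` xsection S w).
  rewrite -[X in measurable X]setTI; apply: measurable_Z => //.
  exact: measurable_xsection.
apply/(negligibleP _ mSw).
have /countable_injP[f finj] := countable_jumps cw.
pose F k := [set w' | exists t, [/\ 0 < t, jump_cmx (X ^~ w) t != 0, f t = k &
  defect (herm_of (Z w') + (left_lim_cmx (X ^~ w) t - X a w))
    (jump_cmx (X ^~ w) t) = 0]].
have : P.-negligible (\bigcup_k F k).
  apply: negligible_bigcup => k.
  have [[t [t0 J0 ftk]]|nt] := pselect (exists t,
      [/\ 0 < t, jump_cmx (X ^~ w) t != 0 & f t = k]); last first.
    apply: negligibleS (negligible_set0 _) => w' [t [t0 J0 ftk _]].
    by apply: nt; exists t.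
  apply: negligibleS (defect_section_null cw t0 J0) => w' [t' [t'0 J'0 ft'k D0]].
  suff -> : t = t' by [].
  by apply: finj; rewrite ?inE// ftk.
apply: negligibleS => w'; rewrite /xsection /= inE /S /=.
move=> /(near_defect_jump cw a0 delta0)[t [t0 J0 D0]].
by exists (f t) => //; exists t.
Qed.

End levy_increments.

(** * Jumps of the eigenvalues at rank one jumps *)

Theorem theorem12 (R : realType) (dO : measure_display)
    (Omega : measurableType dO) (P : probability Omega R) (d : nat)
    (X : R -> Omega -> 'M[R[i]]_d) :
  hermitian_levy_process P X ->
  absolutely_continuous_process P X ->
  {ae P, forall w, forall t, 0 < t ->
    \rank (jump_cmx (X ^~ w) t) = 1%N ->
    ~ comm_mx (X t w) (left_lim_cmx (X ^~ w) t) ->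
    jump_eigvals (X ^~ w) t <> 0 /\
    (forall i : 'I_d,
      jump_eigvals (X ^~ w) t ord0 i <> 0 <->
      forall j : 'I_d, j != i -> jump_eigvals (X ^~ w) t ord0 j <> 0)}.
Proof.
move=> levyX acX.
have inv0 n : 0 < n.+1%:R^-1 :> R by rewrite invr_gt0.
(* Countably many starting times, jump sizes and horizons suffice to catch every jump time, so one
   null set serves for all [t]. *)
have nd : {ae P, forall w, forall n q T,
    ~ near_defect n.+1%:R^-1 q.+1%:R^-1 T%:R (X ^~ w)
        (herm_of (incr X 0 n.+1%:R^-1 w))}.
  do 3![apply: ae_foralln => ?]; exact: near_defect_null.
apply: filterS3 nd (levy_start levyX) (levy_cadlag levyX) => w ndw X0 cw t t0 r1 _.
have hX s : 0 <= s -> X s w \is hermsymmx by move=> s0; exact: (levy_hermitian levyX).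
have J0 : jump_cmx (X ^~ w) t != 0 by rewrite -mxrank_eq0 r1.
have small (e : R) : 0 < e -> exists n, n.+1%:R^-1 < e.
  move=> e0; have /filter_ex[n ne] := near_infty_natSinv_lt (PosNum e0).
  by exists n.
have D0 : defect (left_lim_cmx (X ^~ w) t) (jump_cmx (X ^~ w) t) <> 0.
  move=> D0; have [n nt] := small _ t0.
  have [q qJ] : exists q, q.+1%:R^-1 < sqnorm (jump_cmx (X ^~ w) t).
    by apply: small; rewrite lt_neqAle sqnorm_ge0 eq_sym sqnorm_eq0 J0.
  have tT : t <= (Num.truncn t).+1%:R by rewrite ltW// truncnS_gt.
  apply: (ndw n q (Num.truncn t).+1).
  apply: (jump_near_defect cw (ltW (inv0 n)) nt tT qJ).
  have -> : herm_of (incr X 0 n.+1%:R^-1 w) = X n.+1%:R^-1 w.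
    by have := herm_of_incr levyX w (lexx 0) (ltW (inv0 n)); rewrite X0 subr0.
  by have -> : X n.+1%:R^-1 w + (left_lim_cmx (X ^~ w) t - X n.+1%:R^-1 w) =
    left_lim_cmx (X ^~ w) t by rewrite addrC subrK.
(* The minors of a rank one jump vanish, so a nonzero defect must come from the Sylvester
   determinant. *)
have Ji i : jump_eigvals (X ^~ w) t ord0 i <> 0.
  apply/eqP; apply: jump_eigvals_neq0 => //; apply: contra_notN D0 => /eqP S0.
  by apply/defect_eq0P; split => //; exact: rank1_minors.
(* Every eigenvalue jumps, so both sides of the equivalence hold; rank one forces [0 < d], which
   provides an index for the first claim. *)
split; last by move=> i; split.
have d0 : (0 < d)%N by rewrite -r1 rank_leq_row.
by move=> j0; apply: (Ji (Ordinal d0)); rewrite j0 mxE.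
Qed.
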